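(* Let $P$ be a spiral on $n$ nodes with $k=O(\log n)$ turning points $(tp_1,\dots,tp_k)$, $tp_1$ being the internal and $tp_k$ the external endpoint. Then in the connectivity graph model $P$ can be grown from a single node placed at $tp_k$ in $O(\log n)$ time steps.
   Context: Shapes. Grid points are integer pairs $(x,y)$; two grid points are adjacent if they are at orthogonal (Manhattan) distance $1$. A shape $S=(V,E)$ is a finite connected graph whose nodes occupy distinct grid points and whose edges join only pairs of nodes occupying adjacent points; shapes are considered up to translation, and $n=|V|$. Growth operations. One node, the anchor $u_0$, is stationary; other nodes move relative to it, and a tree is rooted at $u_0$. A growth operation on a node $u$ toward an adjacent grid point $p$ either (i) if $u$ has no edge to $p$, creates a new node $u'$ at $p$ with edge $uu'$; or (ii) if $p$ is occupied by a node $v$ with $uv\in E$, creates a new node $u'$ at $p$, replaces edge $uv$ by edges $uu',u'v$, and translates by one unit, along the axis of $uv$, the part of the tree hanging from whichever of $u,v$ is farther from $u_0$, away from the other endpoint. In one time step a set of operations is applied concurrently, each node receiving at most one operation and all operations having the same cardinal direction; the displacement of each node is the sum of the unit vectors contributed by the operations on its path to $u_0$. The set is collision-free if no two nodes collide during these motions or end at the same point. Growth processes (connectivity graph model). A growth process from an initial shape $S_0$ performs time steps $t=1,2,\dots$, each applying a collision-free set of growth operations to the current shape; no edges are deleted and no edges are created other than by the operations. It grows $S$ from $S_0$ in $t_f$ time steps if the shape obtained after step $t_f$ is $S$. Paths and spirals. For a path $P=(u_1,\dots,u_n)$, $u_i$ is a turning point if $i\in\{1,n\}$ or $u_{i-1}u_i\perp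 u_iu_{i+1}$. A spiral is a path whose turning points, ordered from one endpoint to the other, follow consecutive cardinal directions in a single rotational sense (always clockwise or always counterclockwise). A single spiral winds outward without self-intersection from an internal endpoint $tp_1$ to an external endpoint $tp_k$; segment $s_i$ joins $tp_i$ and $tp_{i+1}$. *)

(* Defs.v *)
From HB Require Import structures.
From mathcomp Require Import all_boot all_order all_algebra.
From mathcomp Require Import finmap.
From mathcomp Require Import boolp.

Set Implicit Arguments.
Unset Strict Implicit.
Unset Printing Implicit Defensive.

Import Order.TTheory GRing.Theory Num.Theory.
Local Open Scope fset_scope.
Local Open Scope ring_scope.

Definition pt := (int * int)%type.
Definition pt0 : pt := (0, 0).
Definition padd (p q : pt) : pt := (p.1 + q.1, p.2 + q.2).
Definition psub (p q : pt) : pt := (p.1 - q.1, p.2 - q.2).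
Definition pscale (z : int) (p : pt) : pt := (z * p.1, z * p.2).

Definition adjacent (p q : pt) : bool := (`|p.1 - q.1|%N + `|p.2 - q.2|%N == 1)%N.

Definition cardinal_dirs : seq pt := [:: (1, 0); (-1, 0); (0, 1); (0, -1)].

(* Shapes (in the coordinates of the stationary anchor): node set and   *)
(* undirected edges, an edge being the 2-element set of its endpoints.  *)
(* Nodes occupy distinct grid points, so a node is identified with its  *)
(* current grid point.                                                  *)

Record shape := Shape { sV : {fset pt}; sE : {fset {fset pt}} }.

Definition edge (x y : pt) : {fset pt} := [fset x; y].

Inductive reach (E : {fset {fset pt}}) : pt -> pt -> Prop :=
| reach_refl x : reach E x x
| reach_step x y z : edge x y \in E -> reach E y z -> reach E x z.

(* w hangs below the edge e (w.r.t. the anchor a): removing e disconnects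
   w from the anchor, i.e. w is in the part of the tree hanging from the
   endpoint of e farther from the anchor. *)
Definition hangs (E : {fset {fset pt}}) (a : pt) (e : {fset pt}) (w : pt) : bool :=
  `[< ~ reach (E `\ e) w a >].

Section Step.
Variables (S : shape) (a d : pt) (U : {fset pt}).

(* operation on u toward p = u + d is of type (ii) iff uv is an edge, v = p *)
Definition splits (u : pt) : bool := edge u (padd u d) \in sE S.

(* unit contribution (as a multiple of d) of the operation on u to the
   displacement of node w: in case (ii) the part of the tree hanging from
   the farther endpoint of uv moves one unit along uv away from the other
   endpoint, i.e. by +d if v = u + d is the farther one, by -d if u is. *)
Definition contrib (u w : pt) : int :=
  if splits u && hangs (sE S) a (edge u (padd u d)) w then
    (if hangs (sE S) a (edge u (padd u d)) (padd u d) then 1 else -1)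
  else 0.

Definition disp (w : pt) : pt := pscale (\sum_(u <- U) contrib u w) d.

Definition fpos (w : pt) : pt := padd w (disp w).

(* final position of the node u' created by the operation on u: adjacent to
   the final position of u in direction d (between u and v in case (ii)) *)
Definition newpos (u : pt) : pt := padd (fpos u) d.

Definition traj (w : pt) (t : rat) : rat * rat :=
  ((w.1)%:~R + t * ((disp w).1)%:~R, (w.2)%:~R + t * ((disp w).2)%:~R).

Definition collision_free : Prop :=
  (forall w1 w2, w1 \in sV S -> w2 \in sV S -> w1 != w2 ->
     forall t : rat, 0 <= t <= 1 -> traj w1 t != traj w2 t)
  /\ (forall u w, u \in U -> w \in sV S -> newpos u != fpos w)
  /\ (forall u1 u2, u1 \in U -> u2 \in U -> u1 != u2 -> newpos u1 != newpos u2).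

Definition map_edge (e : {fset pt}) : {fset pt} := [fset fpos x | x in e].

Definition step_result : shape :=
  Shape ([fset fpos w | w in sV S] `|` [fset newpos u | u in U])
    ([fset map_edge e | e in sE S `\` [fset edge u (padd u d) | u in [fset u in U | splits u]]]
     `|` [fset edge (fpos u) (newpos u) | u in U]
     `|` [fset edge (newpos u) (fpos (padd u d)) | u in [fset u in U | splits u]]).

End Step.

Definition growth_step (a : pt) (S S' : shape) : Prop :=
  exists (d : pt) (U : {fset pt}),
    [/\ d \in cardinal_dirs, U `<=` sV S, collision_free S a d U &
        S' = step_result S a d U].

Inductive grows (a : pt) : nat -> shape -> shape -> Prop :=
| grows0 S : grows a 0 S S
| growsS t S1 S2 S3 : grows a t S1 S2 -> growth_step a S2 S3 -> grows a t.+1 S1 S3.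

Definition grid_path (s : seq pt) : bool :=
  if s is x :: s' then uniq s && path adjacent x s' else false.

Definition path_shape (s : seq pt) : shape :=
  Shape [fset x in s] [fset edge p.1 p.2 | p in zip s (behead s)].

(* direction of the edge u_(i+1) u_(i+2) (0-based: from nth i to nth i+1) *)
Definition pdir (s : seq pt) (i : nat) : pt := psub (nth pt0 s i.+1) (nth pt0 s i).

Definition perp (p q : pt) : bool := p.1 * q.1 + p.2 * q.2 == 0.

Definition turning (s : seq pt) (i : nat) : bool :=
  [|| i == 0%N, i == (size s).-1 | perp (pdir s i.-1) (pdir s i)].

Definition num_turning (s : seq pt) : nat := count (turning s) (iota 0 (size s)).

Definition rot_ccw (p : pt) : pt := (- p.2, p.1).
Definition rot_cw (p : pt) : pt := (p.2, - p.1).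

Definition spiral (s : seq pt) : Prop :=
  grid_path s /\
  exists rot, (rot = rot_ccw \/ rot = rot_cw) /\
    forall i, (0 < i)%N -> (i.+1 < size s)%N -> perp (pdir s i.-1) (pdir s i) ->
      pdir s i = rot (pdir s i.-1).

(* external endpoint: p lies on the outer boundary (bounding box) of s *)
Definition on_outer_boundary (s : seq pt) (p : pt) : bool :=
  [|| all (fun q => q.1 <= p.1) s, all (fun q => p.1 <= q.1) s,
      all (fun q => q.2 <= p.2) s | all (fun q => p.2 <= q.2) s].

(* Main.v *)
Require Import Defs.
From mathcomp Require Import all_boot all_order all_algebra.
From mathcomp Require Import finmap.
From mathcomp Require Import boolp zify ring lra.

(** The path is listed from the external endpoint inwards and encoded by the
    list of its segment lengths. Splitting edges of one axis lets every segment
    of that axis be lengthened by any amount up to doubling. The lengths of an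
    outward winding spiral satisfy a few strict linear inequalities, each
    relating segments of a single axis ([admissible]); these force the nodes to
    be distinct for arbitrary positive edge lengths, and convex combinations
    preserve them, so nothing collides during the linear motion between two
    such spirals.

    The smallest admissible spiral with the given number of segments is grown
    one segment at a time, by appending a node at the inner end after
    lengthening the other segments by at most one. The difference between the
    target lengths and these smallest ones satisfies non-strict homogeneous
    inequalities, hence can be halved again and again; undoing one halving at
    most doubles every length. *)

Set Implicit Arguments.
Unset Strict Implicit.
Unset Printing Implicit Defensive.
Import Order.TTheory GRing.Theory Num.Theory.
Local Open Scope fset_scope.
Local Open Scope ring_scope.

Lemma sum_nseq (V : nmodType) n (x : V) : \sum_(y <- nseq n x) y = x *+ n.
Proof. by rewrite big_nseq -Monoid.iteropE. Qed.

Section Walks.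
Variable V : zmodType.
Implicit Types (a x : V) (u v w : seq V).

Definition walk a v : seq V := a :: scanl +%R a v.

Lemma size_walk a v : size (walk a v) = (size v).+1.
Proof. by rewrite /= size_scanl. Qed.

Lemma foldl_addr a v : foldl +%R a v = a + \sum_(x <- v) x.
Proof.
by elim: v a => [|x v IHv] a /=; rewrite ?big_nil ?addr0 // IHv big_cons addrA.
Qed.

Lemma nth_walk x0 a v i : (i <= size v)%N ->
  nth x0 (walk a v) i = a + \sum_(x <- take i v) x.
Proof. by move=> le_iv; rewrite nth_cons_scanl // foldl_addr. Qed.

Lemma nth_walkS x0 a v i : (i < size v)%N ->
  nth x0 (walk a v) i.+1 = nth x0 (walk a v) i + nth x0 v i.
Proof.
move=> lt_iv; rewrite !nth_walk // ?(ltnW lt_iv) //.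
by rewrite (take_nth x0) // -cats1 big_cat big_seq1 addrA.
Qed.

Lemma last_walk x0 a v : last x0 (walk a v) = a + \sum_(x <- v) x.
Proof. by rewrite -foldl_addr /=; elim: v a => //= x v IHv a. Qed.

Lemma walk_cat a v w :
  walk a (v ++ w) = walk a v ++ scanl +%R (a + \sum_(x <- v) x) w.
Proof. by rewrite /walk scanl_cat foldl_addr. Qed.

Lemma walk_rcons x0 a v x :
  walk a (rcons v x) = rcons (walk a v) (last x0 (walk a v) + x).
Proof. by rewrite -!cats1 walk_cat last_walk. Qed.

Definition partial_sums v : seq V := scanl +%R 0 v.

Lemma scanl_addr a v : scanl +%R a v = [seq a + x | x <- partial_sums v].
Proof.
suff shift b : scanl +%R (a + b) v = [seq a + x | x <- scanl +%R b v].
  by rewrite -shift addr0.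
by elim: v b => //= x v IHv b; rewrite -addrA IHv.
Qed.

Lemma partial_sums_cons x v :
  partial_sums (x :: v) = x :: [seq x + y | y <- partial_sums v].
Proof. by rewrite {1}/partial_sums /= add0r scanl_addr. Qed.

Lemma uniq_walk0 a v : uniq (walk a v) = uniq (walk 0 v).
Proof.
rewrite -(map_inj_uniq (addrI a) (walk 0 v)) /walk map_cons addr0.
by rewrite scanl_addr.
Qed.

Lemma mem_partial_sums_cat u v p : p \in partial_sums (u ++ v) ->
  p \in partial_sums u \/
  exists2 q, q \in partial_sums v & p = \sum_(x <- u) x + q.
Proof.
rewrite /partial_sums scanl_cat mem_cat foldl_addr add0r.
case/orP; first by left.
by rewrite scanl_addr => /mapP[q q_v ->]; right; exists q.
Qed.

Lemma uniq_walk_cat v w : uniq (walk 0 v) -> uniq (walk 0 w) ->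
    (forall p q, p \in walk 0 v -> q \in partial_sums w ->
       p != \sum_(x <- v) x + q) ->
  uniq (walk 0 (v ++ w)).
Proof.
move=> uniq_v; rewrite [uniq (walk 0 w)]cons_uniq => /andP[_ uniq_w] disjoint.
rewrite walk_cat add0r cat_uniq uniq_v scanl_addr.
rewrite (map_inj_uniq (addrI _)) uniq_w andbT; apply/hasPn => _ /mapP[q q_w ->].
by apply/negP => p_v; have /eqP := disjoint _ _ p_v q_w.
Qed.

Lemma walk_differences a v : walk a (pairmap (fun x y => y - x) a v) = a :: v.
Proof. by congr (_ :: _); apply: pairmapK => x y; exact: subrKC. Qed.

Lemma mem_walk_prefix a u w : a + \sum_(x <- u) x \in walk a (u ++ w).
Proof.
by rewrite walk_cat mem_cat -(last_walk 0) -[last 0 _]/(last a _) mem_last.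
Qed.

Lemma uniq_walk_catr a v w :
  uniq (walk a (v ++ w)) -> uniq (walk (a + \sum_(x <- v) x) w).
Proof.
elim: v a => [|x v IHv] a; first by rewrite big_nil addr0.
by rewrite big_cons addrA => /andP[_]; exact: IHv.
Qed.

Lemma uniq_walk_no_cycle a v w :
  uniq (walk a (v ++ w)) -> \sum_(x <- v) x = 0 -> v = [::].
Proof.
move=> uniq_vw sum_v; apply/nilP; have sz : (size v < size (walk a (v ++ w)))%N.
  by rewrite size_walk size_cat ltnS leq_addr.
rewrite /nilp -(nth_uniq 0 sz _ uniq_vw) // !nth_walk ?size_cat ?leq_addr //.
by rewrite take_size_cat // sum_v take0 big_nil.
Qed.

End Walks.

Section Coils.
Variable V : zmodType.
Implicit Types (e f : V) (l : seq nat).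

Fixpoint coil e f l : seq V :=
  if l is n :: l' then nseq n e ++ coil f (- e) l' else [::].

Lemma size_coil e f l : size (coil e f l) = sumn l.
Proof. by elim: l e f => //= n l IHl e f; rewrite size_cat size_nseq IHl. Qed.

Lemma coil_cat e f l1 l2 : exists e' f',
  coil e f (l1 ++ l2) = coil e f l1 ++ coil e' f' l2.
Proof.
elim: l1 e f => [|n l1 IHl1] e f; first by exists e, f.
have [e' [f' eq_coil]] := IHl1 f (- e).
by exists e', f'; rewrite /= eq_coil catA.
Qed.

End Coils.

Section WeightedCoils.
Variable R : realFieldType.
Local Notation plane := (R^o * R^o)%type.
Implicit Types (c : R) (e f p q : plane) (w : seq R) (ws : seq (seq R)).

Definition dot e p : R := e.1 * p.1 + e.2 * p.2.

Definition orthonormal e f := [/\ dot e e = 1, dot f f = 1 & dot e f = 0].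

Lemma dotC e p : dot e p = dot p e.
Proof. by rewrite /dot; ring. Qed.

Lemma dotDr e p q : dot e (p + q) = dot e p + dot e q.
Proof. by rewrite /dot /=; ring. Qed.

Lemma dotNl e p : dot (- e) p = - dot e p.
Proof. by rewrite /dot /=; ring. Qed.

Lemma dotZr e c p : dot e (c *: p) = c * dot e p.
Proof. by rewrite /dot /= /GRing.scale /=; ring. Qed.

Lemma orthonormal_rot e f : orthonormal e f -> orthonormal f (- e).
Proof.
case=> ee ff ef; split=> //; first by rewrite dotNl dotC dotNl opprK.
by rewrite dotC dotNl ef oppr0.
Qed.

Definition positive w := all (fun c => 0 < c) w.

Lemma sum_ge0_positive w : positive w -> 0 <= \sum_(c <- w) c.
Proof.
by move=> w_gt0; rewrite big_seq sumr_ge0 // => c /(allP w_gt0)/ltW.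
Qed.

Definition segment e w : seq plane := [seq c *: e | c <- w].

Fixpoint weighted_coil e f ws : seq plane :=
  if ws is w :: ws' then segment e w ++ weighted_coil f (- e) ws' else [::].

Definition lengths ws : seq R := [seq \sum_(c <- w) c | w <- ws].

Definition shrinking (l : seq R) :=
  forall i, (i < size l)%N -> nth 0 l i.+2 < nth 0 l i.

Lemma shrinking_behead c (l : seq R) : shrinking (c :: l) -> shrinking l.
Proof. by move=> shr i lt_il; exact: (shr i.+1). Qed.

Lemma lengths_ge0 ws i : all positive ws -> 0 <= nth 0 (lengths ws) i.
Proof.
move=> ws_gt0; have [lt_i|le_i] := ltnP i (size ws); last first.
  by rewrite nth_default // size_map.
rewrite (nth_map [::]) //; apply: sum_ge0_positive.
exact: (allP ws_gt0 _ (mem_nth [::] lt_i)).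
Qed.

Lemma sum_segment e w : \sum_(p <- segment e w) p = (\sum_(c <- w) c) *: e.
Proof. by rewrite big_map scaler_suml. Qed.

Lemma mem_segment e w p : positive w ->
  p \in partial_sums (segment e w) ->
  exists2 c, 0 < c <= \sum_(c <- w) c & p = c *: e.
Proof.
elim: w p => [|c w IHw] p //= /andP[c_gt0 w_gt0].
have sum_ge0 := sum_ge0_positive w_gt0.
rewrite partial_sums_cons inE big_cons => /orP[/eqP->|/mapP[q q_w ->]].
  by exists c => //; rewrite c_gt0 lerDl.
have [c' /andP[c'_gt0 le_c'] ->] := IHw _ w_gt0 q_w.
by exists (c + c'); rewrite ?scalerDl // addr_gt0 // lerD2l.
Qed.

Lemma mem_walk_segment e w p : positive w ->
  p \in walk 0 (segment e w) ->
  exists2 c, 0 <= c <= \sum_(c <- w) c & p = c *: e.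
Proof.
move=> w_gt0; rewrite inE => /orP[/eqP->|].
  by exists 0; rewrite ?scale0r // lexx sum_ge0_positive.
case/(mem_segment w_gt0) => c /andP[/ltW c_ge0 le_c] ->.
by exists c; rewrite ?c_ge0.
Qed.

Lemma uniq_walk_segment e w : dot e e = 1 -> positive w ->
  uniq (walk 0 (segment e w)).
Proof.
move=> ee; elim: w => // c w IHw cw_gt0; have /andP[_ w_gt0] := cw_gt0.
have -> : walk 0 (segment e (c :: w)) = 0 :: walk (c *: e) (segment e w).
  by rewrite /walk /= add0r.
rewrite cons_uniq uniq_walk0 IHw // andbT.
have := @mem_segment e (c :: w) 0 cw_gt0; rewrite /= partial_sums_cons => mem0.
apply/negP; rewrite /walk scanl_addr => /mem0[c' /andP[c'_gt0 _]].
move=> /(congr1 (dot e)).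
rewrite dotZr ee mulr1 /dot /= !mulr0 addr0 => c'_eq0.
by rewrite -c'_eq0 ltxx in c'_gt0.
Qed.

Lemma mem_weighted_coil e f w ws p : positive w ->
  p \in partial_sums (weighted_coil e f (w :: ws)) ->
  (exists2 c, 0 < c <= \sum_(c <- w) c & p = c *: e) \/
  (exists2 q, q \in partial_sums (weighted_coil f (- e) ws) &
     p = (\sum_(c <- w) c) *: e + q).
Proof.
move=> w_gt0 /mem_partial_sums_cat[/(mem_segment w_gt0)|[q q_ws ->]].
  by left.
by rewrite sum_segment; right; exists q.
Qed.

Lemma shrinking_coil_box e f ws p : orthonormal e f -> all positive ws ->
    shrinking (lengths ws) -> p \in partial_sums (weighted_coil e f ws) ->
  [/\ 0 < dot e p, dot e p <= nth 0 (lengths ws) 0,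
      0 <= dot f p & dot f p <= nth 0 (lengths ws) 1].
Proof.
elim: ws e f p => [|w ws IHws] e f p // ef /andP[w_gt0 ws_gt0] shr.
have [ee ff fe] := ef; have len1 := lengths_ge0 0 ws_gt0.
have len2 := lengths_ge0 1 ws_gt0; have len02 := shr 0%N isT.
case/(mem_weighted_coil w_gt0) => [[c /andP[c_gt0 le_c] ->]|[q q_ws ->]].
  by rewrite !dotZr (dotC f) ee fe mulr1 mulr0.
have := IHws _ _ _ (orthonormal_rot ef) ws_gt0 (shrinking_behead shr) q_ws.
rewrite !dotDr !dotZr (dotC f e) ee fe dotNl; move: len1 len2 len02 => /=.
set l1 := nth 0 _ 0; set l2 := nth 0 _ 1; set l0 := \sum_(c <- w) c.
by move=> ? ? ? [? ? ? ?]; split; lra.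
Qed.

Lemma shrinking_coil_after_first e f w ws p : orthonormal e f ->
    all positive (w :: ws) -> shrinking (lengths (w :: ws)) ->
    p \in partial_sums (weighted_coil e f (w :: ws)) ->
  (exists c, p = c *: e) \/
  (0 < size ws)%N /\ \sum_(c <- w) c - nth 0 (lengths ws) 1 <= dot e p.
Proof.
move=> ef /andP[w_gt0 ws_gt0] shr.
case/(mem_weighted_coil w_gt0) => [[c _ ->]|[q q_ws ->]].
  by left; exists c.
right; split; first by case: (ws) q_ws.
have [_ _ _] := shrinking_coil_box (orthonormal_rot ef) ws_gt0
  (shrinking_behead shr) q_ws.
by case: ef => ee _ _; rewrite dotDr dotZr ee dotNl; lra.
Qed.

Lemma uniq_shrinking_coil e f ws : orthonormal e f -> all positive ws ->
  shrinking (lengths ws) -> uniq (walk 0 (weighted_coil e f ws)).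
Proof.
elim: ws e f => [|w ws IHws] e f //= ef /andP[w_gt0 ws_gt0] shr.
have [ee ff fe] := ef; have fe_frame := orthonormal_rot ef.
have shr_ws := shrinking_behead shr.
apply: uniq_walk_cat; first exact: uniq_walk_segment.
  exact: IHws.
move=> p q /(mem_walk_segment w_gt0)[c _ ->] q_ws.
have [f_gt0 _ _ _] := shrinking_coil_box fe_frame ws_gt0 shr_ws q_ws.
rewrite sum_segment; apply/eqP => /(congr1 (dot f)).
by rewrite dotDr !dotZr (dotC f e) fe; lra.
Qed.

(* The second and third segments stay off the line of the first one; the later
   ones stay strictly behind its starting point. *)
Lemma uniq_weighted_coil e f w0 w1 ws : orthonormal e f ->
    all positive [:: w0, w1 & ws] -> 0 < \sum_(c <- w1) c ->
    shrinking (lengths ws) ->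
    ((1 < size ws)%N ->
     \sum_(c <- w0) c + nth 0 (lengths ws) 2 < nth 0 (lengths ws) 0) ->
  uniq (walk 0 (weighted_coil e f [:: w0, w1 & ws])).
Proof.
move=> ef /and3P[w0_gt0 w1_gt0 ws_gt0] len1_gt0 shr len02 /=.
have fe := orthonormal_rot ef; have ee := orthonormal_rot fe.
have [dot_ee dot_ff dot_ef] := ef.
apply: uniq_walk_cat; first exact: uniq_walk_segment.
  apply: uniq_walk_cat; first exact: uniq_walk_segment.
    exact: uniq_shrinking_coil.
  move=> p q /(mem_walk_segment w1_gt0)[c _ ->] q_ws.
  have [e_gt0 _ _ _] := shrinking_coil_box ee ws_gt0 shr q_ws.
  rewrite sum_segment; apply/eqP => /(congr1 (dot e)).
  by move: e_gt0; rewrite dotNl dotDr !dotZr dot_ef; lra.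
move=> p q /(mem_walk_segment w0_gt0)[c /andP[c_ge0 le_c] ->] q_w1ws.
rewrite sum_segment; apply/eqP => meet.
have meet_e := congr1 (dot e) meet; have meet_f := congr1 (dot f) meet.
move: meet_e meet_f; rewrite !dotDr !dotZr (dotC f e) dot_ee dot_ef.
case/(mem_weighted_coil w1_gt0): q_w1ws.
  by case=> c' /andP[c'_gt0 _] ->; rewrite !dotZr dot_ff; lra.
case=> r r_ws ->.
rewrite !dotDr !dotZr dot_ff dot_ef.
case: ws ws_gt0 shr len02 r_ws => [|w2 ws] // ws_gt0 shr len02 r_ws.
have [[c' ->]|[ws_n0 far]] := shrinking_coil_after_first ee ws_gt0 shr r_ws.
  by rewrite !dotZr (dotC f) !dotNl dot_ef; lra.
by move: far (len02 ws_n0); rewrite dotNl /=; lra.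
Qed.

End WeightedCoils.

Arguments positive {R} w.

Section PathShapes.
Implicit Types (x y z u w : pt) (s : seq pt) (S : Defs.shape).

Lemma shape_eqP S S' : sV S =i sV S' -> sE S =i sE S' -> S = S'.
Proof. by case: S S' => [V E] [V' E'] /= /fsetP -> /fsetP ->. Qed.

Lemma edgeC x y : edge x y = edge y x.
Proof. exact: fsetUC. Qed.

Lemma edge_inj x y z w :
  edge x y = edge z w -> (x = z /\ y = w) \/ (x = w /\ y = z).
Proof.
move=> /fsetP eq_xy_zw.
have := eq_xy_zw w; have := eq_xy_zw z; have := eq_xy_zw y; have := eq_xy_zw x.
rewrite !in_fset2 !eqxx ?orbT ?orTb => /esym/orP[]/eqP-> /esym/orP[]/eqP->;
  rewrite ?orbb ?eqxx ?orbT ?orTb; auto.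
  by move=> _ /eqP->; auto.
by move=> /eqP-> _; auto.
Qed.

Lemma in_path_shape s x : (x \in sV (path_shape s)) = (x \in s).
Proof. by rewrite in_fset. Qed.

Lemma path_shape_edgeP s e :
  reflect
    (exists2 i, (i.+1 < size s)%N & e = edge (nth pt0 s i) (nth pt0 s i.+1))
    (e \in sE (path_shape s)).
Proof.
have size_links : size (zip s (behead s)) = (size s).-1.
  by rewrite size2_zip size_behead // leq_pred.
apply: (iffP (imfsetP _ _ _ _)) => /= [[p /(nthP (pt0, pt0))[i] lt_i <- ->]|].
  exists i; first by move: lt_i; rewrite size_links; lia.
  by rewrite nth_zip_cond lt_i -nth_behead.
case=> i lt_i ->; have {}lt_i : (i < size (zip s (behead s)))%N.
  by rewrite size_links; lia.
exists (nth (pt0, pt0) (zip s (behead s)) i); first exact: mem_nth.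
by rewrite nth_zip_cond lt_i nth_behead.
Qed.

Lemma path_shape_rev s : path_shape (rev s) = path_shape s.
Proof.
have edge_rev e s1 : e \in sE (path_shape (rev s1)) -> e \in sE (path_shape s1).
  case/path_shape_edgeP => i; rewrite size_rev => lt_i ->.
  apply/path_shape_edgeP; exists (size s1 - i.+2)%N; first by lia.
  by rewrite !nth_rev ?(ltnW lt_i) // edgeC; congr (edge _ (nth _ _ _)); lia.
apply: shape_eqP => x; first by rewrite !in_path_shape mem_rev.
by apply/idP/idP => [/edge_rev//|]; rewrite -{1}(revK s) => /edge_rev.
Qed.

Lemma path_shape1 x : path_shape [:: x] = Shape [fset x] fset0.
Proof.
apply: shape_eqP => y; first by rewrite in_path_shape !inE.
by rewrite in_fset0; apply/path_shape_edgeP => -[].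
Qed.

Lemma path_shape_rcons s x : s != [::] ->
  path_shape (rcons s x) =
  Shape (x |` sV (path_shape s)) (edge (last pt0 s) x |` sE (path_shape s)).
Proof.
move=> s_n0; have sz : (0 < size s)%N by case: (s) s_n0.
have nth_s i : (i < size s)%N -> nth pt0 (rcons s x) i = nth pt0 s i.
  by move=> lt_i; rewrite nth_rcons lt_i.
apply: shape_eqP => y.
  by rewrite in_path_shape mem_rcons in_cons in_fset1U in_path_shape.
rewrite in_fset1U -nth_last; apply/path_shape_edgeP/orP => [[i]|].
  rewrite size_rcons ltnS leq_eqVlt => /orP[/eqP eq_i|lt_i] ->.
    by left; rewrite -eq_i /= nth_s -?eq_i // nth_rcons eq_i ltnn eqxx.
  right; apply/path_shape_edgeP; exists i => //.
  by rewrite !nth_s // ltnW.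
case=> [/eqP ->|/path_shape_edgeP[i lt_i ->]].
  exists (size s).-1; rewrite prednK // ?size_rcons //.
  by rewrite nth_s ?prednK // nth_rcons ltnn eqxx.
by exists i; rewrite ?size_rcons ?nth_s //; apply: ltnW.
Qed.

Lemma hangs_path s i j : uniq s -> (i.+1 < size s)%N -> (j < size s)%N ->
  hangs (sE (path_shape s)) (nth pt0 s 0)
    (edge (nth pt0 s i) (nth pt0 s i.+1)) (nth pt0 s j) = (i < j)%N.
Proof.
move=> uniq_s lt_i lt_j.
have nth_inj k k' : (k < size s)%N -> (k' < size s)%N ->
    nth pt0 s k = nth pt0 s k' -> k = k'.
  by move=> lt_k lt_k' /eqP; rewrite nth_uniq // => /eqP.
have prefix_of_root x y k : (k < size s)%N ->
    reach (sE (path_shape s) `\ edge (nth pt0 s i) (nth pt0 s i.+1)) x y ->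
    x = nth pt0 s k -> y = nth pt0 s 0 -> (k <= i)%N.
  move=> + reach_xy; elim: reach_xy k => {x y} [x k lt_k -> /nth_inj|x y z].
    by lia.
  rewrite in_fsetD1 => /andP[/eqP xy_cut /path_shape_edgeP[k lt_k xy_k]].
  move=> _ IHy m lt_m eq_x eq_z; have neq_ki : k <> i by move=> eq_ki; subst k.
  have [[]|[]] := edge_inj xy_k; rewrite eq_x => /nth_inj eq_mk eq_y.
    by have := IHy _ lt_k eq_y eq_z; lia.
  by have := IHy _ (ltnW lt_k) eq_y eq_z; lia.
rewrite /hangs ltnNge; apply/asboolP/negP => [not_reach le_ji|lt_ij reach_j].
  apply: not_reach; elim: j lt_j le_ji => [|j IHj] lt_j le_ji.
    exact: reach_refl.
  apply: (@reach_step _ _ (nth pt0 s j)); last by apply: IHj; lia.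
  rewrite in_fsetD1 edgeC; apply/andP; split; last first.
    by apply/path_shape_edgeP; exists j.
  apply/eqP => /edge_inj.
  by case=> -[/nth_inj eq_ji /nth_inj eq_ij]; lia.
exact: lt_ij (prefix_of_root _ _ _ lt_j reach_j erefl erefl).
Qed.

End PathShapes.

Lemma paddE (p q : pt) : padd p q = p + q.
Proof. by []. Qed.

Section GrowthSteps.
Implicit Types (a d x y u w : pt) (S : Defs.shape) (U : {fset pt}).

Lemma disp_sum S a d U w :
  disp S a d U w = \sum_(u <- U) pscale (contrib S a d u w) d.
Proof.
rewrite /disp; elim: (enum_fset U) => [|u r IHr]; rewrite ?big_nil ?big_cons.
  by rewrite /pscale !mul0r.
by rewrite -IHr /pscale !mulrDl.
Qed.

Lemma map_edge_edge S a d U x y :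
  map_edge S a d U (edge x y) = edge (fpos S a d U x) (fpos S a d U y).
Proof. exact: imfset_fset2. Qed.

Lemma leaf_growth_step a d u S : d \in cardinal_dirs -> u \in sV S ->
    u + d \notin sV S -> edge u (u + d) \notin sE S ->
  growth_step a S (Shape (u + d |` sV S) (edge u (u + d) |` sE S)).
Proof.
move=> d_card u_S ud_S nsplit; have disp0 w : disp S a d [fset u] w = 0.
  rewrite /disp big_seq_fset1 /contrib /splits paddE (negPf nsplit).
  by rewrite /pscale !mul0r.
have fpos_id w : fpos S a d [fset u] w = w by rewrite /fpos disp0 paddE addr0.
have newposE w : newpos S a d [fset u] w = w + d by rewrite /newpos fpos_id.
have map_id e : map_edge S a d [fset u] e = e.
  by rewrite /map_edge (eq_imfset _ fpos_id (frefl _)) imfset_id.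
have no_split : [fset x in [fset u] | splits S d x] = fset0.
  apply/fsetP => x; rewrite !inE /=; apply/negP => /andP[/eqP ->].
  by rewrite /splits paddE (negPf nsplit).
exists d, [fset u]; split=> //; first by rewrite fsub1set.
- split; last split.
  + move=> w1 w2 _ _ neq_w t _; rewrite /traj !disp0 /= !mulr0 !addr0.
    apply: contra_neq neq_w => -[/intr_inj + /intr_inj].
    by case: w1 w2 => [? ?] [? ?] /= -> ->.
  + move=> x w; rewrite in_fset1 => /eqP-> w_S; rewrite newposE fpos_id.
    by apply: contraNneq ud_S => ->.
  + by move=> x y; rewrite !in_fset1 => /eqP-> /eqP->; rewrite eqxx.
rewrite /step_result no_split !imfset0 fsetD0 fsetU0.
rewrite (eq_imfset _ fpos_id (frefl _)) (eq_imfset _ map_id (frefl _)).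
rewrite !imfset_id !imfset_fset1 newposE fpos_id.
by congr Shape; rewrite fsetUC.
Qed.

End GrowthSteps.

Definition embed (p : pt) : rat^o * rat^o := (p.1%:~R, p.2%:~R).

Lemma embedD p q : embed (p + q) = embed p + embed q.
Proof. by rewrite /embed /= !intrD. Qed.

Lemma embedN p : embed (- p) = - embed p.
Proof. by rewrite /embed /= !mulrNz. Qed.

Lemma embed_inj : injective embed.
Proof. by move=> [x y] [x' y'] [/intr_inj -> /intr_inj ->]. Qed.

Lemma map_embed_walk a v : map embed (walk a v) = walk (embed a) (map embed v).
Proof.
rewrite /walk /=; congr (_ :: _).
by elim: v a => //= x v IHv a; rewrite IHv embedD.
Qed.

Definition doubled (m : seq (pt * bool)) : seq pt :=
  flatten [seq nseq p.2.+1 p.1 | p : pt * bool <- m].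

(* Over one unit of time a marked step grows linearly to twice its length. *)
Definition stretched (t : rat) (m : seq (pt * bool)) : seq (rat^o * rat^o) :=
  [seq (1 + t * p.2%:R) *: embed p.1 | p : pt * bool <- m].

Lemma doubled_cat m1 m2 : doubled (m1 ++ m2) = doubled m1 ++ doubled m2.
Proof. by rewrite /doubled map_cat flatten_cat. Qed.

Lemma stretched0 m : stretched 0 m = map embed (unzip1 m).
Proof.
rewrite -map_comp; apply: eq_map => p /=.
by rewrite mul0r addr0 scale1r.
Qed.

Lemma cardinal_neqN d : d \in cardinal_dirs -> (- d == d) = false.
Proof. by rewrite !inE => /or4P[] /eqP->. Qed.

Section SplitStep.
Variables (a d : pt) (m : seq (pt * bool)).
Hypothesis d_card : d \in cardinal_dirs.
Hypothesis marked_dir : forall p, p \in m -> p.2 -> p.1 = d \/ p.1 = - d.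
Hypothesis uniq_stretched :
  forall t, 0 <= t <= 1 -> uniq (walk (embed a) (stretched t m)).
Hypothesis uniq_doubled : uniq (walk a (doubled m)).

Let n := size m.
Let step i := (nth (pt0, false) m i).1.
Let marked i := (nth (pt0, false) m i).2.
Let node := nth pt0 (walk a (unzip1 m)).
Let new_node := nth pt0 (walk a (doubled m)).
(* The node [node i] ends up as [new_node (slot i)]. *)
Let slot i := size (doubled (take i m)).
Let S := path_shape (walk a (unzip1 m)).

Let size_steps : size (unzip1 m) = n.
Proof. exact: size_map. Qed.

Let uniq_nodes : uniq (walk a (unzip1 m)).
Proof.
rewrite -(map_inj_uniq embed_inj) map_embed_walk -stretched0.
by rewrite uniq_stretched // lexx ler01.
Qed.

Lemma nodeS i : (i < n)%N -> node i.+1 = node i + step i.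
Proof.
by move=> lt_i; rewrite /node nth_walkS ?size_steps // (nth_map (pt0, false)).
Qed.

Lemma slot0 : slot 0 = 0%N.
Proof. by rewrite /slot take0. Qed.

Lemma slotS i : (i < n)%N -> slot i.+1 = (slot i + (marked i).+1)%N.
Proof.
move=> lt_i; rewrite /slot (take_nth (pt0, false)) // -cats1 doubled_cat.
by rewrite size_cat /doubled /= cats0 size_nseq.
Qed.

Lemma slot_size : slot n = size (doubled m).
Proof. by rewrite /slot take_size. Qed.

Lemma leq_slot i j : (i <= j <= n)%N -> (slot i <= slot j)%N.
Proof.
elim: j => [|j IHj]; first by case: i.
rewrite leq_eqVlt => /andP[/orP[/eqP-> //|lt_ij] lt_j].
by rewrite (leq_trans (IHj _)) ?slotS ?leq_addr //; lia.
Qed.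

Lemma ltn_slot i j : (i < j <= n)%N -> (slot i + marked i < slot j)%N.
Proof.
move=> /andP[lt_ij le_j]; have lt_i := leq_trans lt_ij le_j.
by have := leq_slot (i := i.+1) (j := j); rewrite slotS //; lia.
Qed.

Lemma slot_cases k : (k < slot n)%N ->
  exists2 i, (i < n)%N & k = slot i \/ marked i /\ k = (slot i).+1.
Proof.
suff below j : (j <= n)%N -> (k < slot j)%N ->
    exists2 i, (i < j)%N & k = slot i \/ marked i /\ k = (slot i).+1.
  exact: below.
elim: j => [|j IHj] lt_j; first by rewrite slot0.
have [/(IHj (ltnW lt_j))[i lt_i slot_i] _|le_k] := ltnP k (slot j).
  by exists i; rewrite // ltnW.
rewrite slotS // => lt_k; exists j => //.
have [->|neq_k] := eqVneq k (slot j); first by left.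
by right; case: (marked j) lt_k => /= lt_k; split=> //; lia.
Qed.

Lemma slot_inj i j :
  (i <= n)%N -> (j <= n)%N -> slot i = slot j -> i = j.
Proof.
move=> le_i le_j eq_ij; case: (ltngtP i j) => // [lt_ij|lt_ji].
  by have := ltn_slot (i := i) (j := j); lia.
by have := ltn_slot (i := j) (j := i); lia.
Qed.

Lemma inserted_slot_neq i j :
  (i < n)%N -> marked i -> (j <= n)%N -> (slot i).+1 != slot j.
Proof.
move=> lt_i i_marked le_j; have [le_ji|lt_ij] := leqP j i.
  by have := leq_slot (i := j) (j := i); lia.
by have := ltn_slot (i := i) (j := j); rewrite i_marked; lia.
Qed.

Lemma nth_doubled i k : (i < n)%N -> (k <= marked i)%N ->
  nth pt0 (doubled m) (slot i + k) = step i.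
Proof.
move=> lt_i le_k; rewrite -[in LHS](cat_take_drop i m).
rewrite (drop_nth (pt0, false)) // doubled_cat nth_cat -/(slot i).
rewrite ltnNge leq_addr addKn /=.
by rewrite nth_cat size_nseq ltnS le_k nth_nseq ltnS le_k.
Qed.

Lemma new_node_slotS i : (i < n)%N ->
  new_node (slot i).+1 = new_node (slot i) + step i.
Proof.
move=> lt_i; rewrite /new_node nth_walkS; last first.
  by rewrite -slot_size; have := ltn_slot (i := i) (j := n); lia.
by rewrite -[X in nth _ (doubled m) X]addn0 nth_doubled.
Qed.

Lemma new_node_slotSS i : (i < n)%N -> marked i ->
  new_node (slot i).+2 = new_node (slot i).+1 + step i.
Proof.
move=> lt_i i_marked; rewrite /new_node nth_walkS; last first.
  rewrite -slot_size; have := ltn_slot (i := i) (j := n).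
  by rewrite i_marked; lia.
by rewrite -[X in nth _ (doubled m) X]addn1 nth_doubled ?i_marked.
Qed.

Lemma new_node_slot_next i : (i < n)%N ->
  new_node (slot i.+1) = new_node (slot i) + step i *+ (marked i).+1.
Proof.
move=> lt_i; rewrite slotS //; case i_marked: (marked i).
  by rewrite addn2 new_node_slotSS // new_node_slotS // mulr2n addrA.
by rewrite addn1 new_node_slotS.
Qed.

Lemma new_node_inj k k' : (k <= slot n)%N -> (k' <= slot n)%N ->
  new_node k = new_node k' -> k = k'.
Proof.
rewrite slot_size => le_k le_k' /eqP.
by rewrite nth_uniq ?size_walk ?ltnS // => /eqP.
Qed.

Let I := [fset i in iota 0 n | marked i].
Let split_node i := if step i == d then node i else node i.+1.
Let U := [fset split_node i | i in I].

Lemma mem_marked i : (i \in I) = (i < n)%N && marked i.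
Proof. by rewrite !inE /= mem_iota. Qed.

Lemma split_node_cases i : i \in I ->
  [/\ split_node i = node i, split_node i + d = node i.+1 & step i = d] \/
  [/\ split_node i = node i.+1, split_node i + d = node i & step i = - d].
Proof.
rewrite mem_marked /split_node => /andP[lt_i i_marked]; rewrite nodeS //.
have [->|->] : step i = d \/ step i = - d.
  by apply: marked_dir; rewrite ?mem_nth.
  by left; rewrite eqxx.
by right; rewrite cardinal_neqN // subrK.
Qed.

Lemma edge_split_node i : i \in I ->
  edge (split_node i) (split_node i + d) = edge (node i) (node i.+1).
Proof. by case/split_node_cases => -[-> -> _] //; rewrite edgeC. Qed.

Lemma edge_node_inj i j : (i < n)%N -> (j < n)%N ->
  edge (node i) (node i.+1) = edge (node j) (node j.+1) -> i = j.
Proof.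
have node_inj k k' : (k <= n)%N -> (k' <= n)%N -> node k = node k' -> k = k'.
  by move=> le_k le_k' /eqP; rewrite nth_uniq ?size_walk ?size_steps // => /eqP.
move=> lt_i lt_j /edge_inj[[/node_inj eq_ij _]|[/node_inj eq_i /node_inj eq_j]].
  by apply: eq_ij; apply: ltnW.
by have := eq_i (ltnW lt_i) lt_j; have := eq_j lt_i (ltnW lt_j); lia.
Qed.

Lemma split_node_inj : {in I &, injective split_node}.
Proof.
move=> i j i_I j_I eq_ij; have := edge_split_node i_I.
rewrite eq_ij edge_split_node // => eq_edge.
move: i_I j_I; rewrite !mem_marked => /andP[lt_i _] /andP[lt_j _].
by apply/esym/edge_node_inj.
Qed.

Lemma node_edgeP e :
  reflect (exists2 i, (i < n)%N & e = edge (node i) (node i.+1)) (e \in sE S).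
Proof.
apply: (iffP (path_shape_edgeP _ _)) => -[i];
  by rewrite ?size_walk ?size_steps ?ltnS => lt_i ->; exists i;
     rewrite ?size_walk ?size_steps.
Qed.

Lemma nodeP x : reflect (exists2 i, (i <= n)%N & x = node i) (x \in sV S).
Proof.
rewrite in_path_shape; apply: (iffP (nthP pt0)) => -[i le_i eq_x];
  by exists i; rewrite // size_walk size_steps in le_i *.
Qed.

Lemma splits_split_node i : i \in I -> splits S d (split_node i).
Proof.
move=> i_I; rewrite /splits paddE edge_split_node //; apply/node_edgeP.
by exists i => //; move: i_I; rewrite mem_marked => /andP[].
Qed.

Lemma contrib_split_node i j : i \in I -> (j <= n)%N ->
  pscale (contrib S a d (split_node i) (node j)) d =
  if (i < j)%N then step i else 0.
Proof.
move=> i_I le_j; move: (i_I); rewrite mem_marked => /andP[lt_i _].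
have hangsE k : (k <= n)%N ->
    hangs (sE S) a (edge (node i) (node i.+1)) (node k) = (i < k)%N.
  by move=> le_k; apply: (hangs_path uniq_nodes); rewrite size_walk size_steps.
rewrite /contrib splits_split_node // paddE edge_split_node // hangsE //=.
case: ltnP => _; last by rewrite /pscale !mul0r.
case: (split_node_cases i_I) => -[_ -> ->]; rewrite hangsE ?(ltnW lt_i) //.
  by rewrite ltnSn /pscale !mul1r; case: d.
by rewrite ltnn /pscale !mulN1r; case: d.
Qed.

Lemma disp_node_sum j : (j <= n)%N ->
  disp S a d U (node j) = \sum_(0 <= i < j | marked i) step i.
Proof.
move=> le_j; rewrite disp_sum big_imfset /=; last exact: split_node_inj.
rewrite (eq_big_seq (fun i => if (i < j)%N then step i else 0)); last first.
  by move=> i i_I; rewrite contrib_split_node.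
have perm_I : perm_eq I [seq i <- iota 0 n | marked i].
  apply: uniq_perm; rewrite ?fset_uniq ?filter_uniq ?iota_uniq // => i.
  by rewrite mem_marked mem_filter mem_iota andbC.
rewrite (perm_big _ perm_I) big_filter -big_mkcondr /=.
have -> : iota 0 n = index_iota 0 n by rewrite /index_iota subn0.
rewrite (big_cat_nat (leq0n j) le_j) //=.
rewrite [X in _ + X]big_nat_cond [X in _ + X]big1 ?addr0.
  rewrite big_nat_cond [RHS]big_nat_cond; apply: eq_bigl => i.
  by case: (ltnP i j); rewrite ?andbF ?andbT.
by move=> i /andP[/andP[le_ji _]]; rewrite ltnNge le_ji andbF.
Qed.

Lemma disp_node j : (j <= n)%N ->
  disp S a d U (node j) = new_node (slot j) - node j.
Proof.
move=> le_j; rewrite disp_node_sum //.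
elim: j le_j => [|j IHj] lt_j; first by rewrite big_geq // slot0 subrr.
rewrite big_mkcond big_nat_recr // -big_mkcond /= IHj ?(ltnW lt_j) //.
rewrite nodeS // new_node_slot_next // mulrS opprD addrACA.
by rewrite [_ + step j *+ _]addrC addrK; case: (marked j).
Qed.

Lemma traj_node t j : (j <= n)%N ->
  traj S a d U (node j) t = nth 0 (walk (embed a) (stretched t m)) j.
Proof.
move=> le_j; rewrite /traj disp_node //.
transitivity
  (embed (node j) + t *: (embed (new_node (slot j)) - embed (node j))).
  by rewrite /embed /= !rmorphB.
elim: j le_j => [|j IHj] lt_j; first by rewrite slot0 subrr scaler0 addr0.
rewrite nth_walkS ?size_map // -IHj ?(ltnW lt_j) // (nth_map (pt0, false)) //.
rewrite nodeS // new_node_slot_next // -/(step j) -/(marked j).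
case: (marked j); rewrite /= ?mulr2n !embedD;
  case: (embed (step j)) (embed (node j)) (embed (new_node _)) =>
    [? ?] [? ?] [? ?];
  by congr (_, _); rewrite /= /GRing.scale /=; ring.
Qed.

Lemma fpos_node j : (j <= n)%N -> fpos S a d U (node j) = new_node (slot j).
Proof. by move=> le_j; rewrite /fpos disp_node // paddE addrC subrK. Qed.

Lemma newpos_split_node i : i \in I ->
  newpos S a d U (split_node i) = new_node (slot i).+1.
Proof.
move=> i_I; move: (i_I); rewrite mem_marked => /andP[lt_i i_marked].
rewrite /newpos paddE; case: (split_node_cases i_I) => -[-> _ step_i].
  by rewrite fpos_node ?(ltnW lt_i) // new_node_slotS // step_i.
rewrite fpos_node // slotS // i_marked addn2 new_node_slotSS // step_i.
by rewrite subrK.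
Qed.

Lemma marked_slot_lt i : i \in I -> ((slot i).+1 < slot n)%N.
Proof.
rewrite mem_marked => /andP[lt_i i_marked].
by have := ltn_slot (i := i) (j := n); rewrite i_marked; lia.
Qed.

Lemma mem_split_nodes u : u \in U -> exists2 i, i \in I & u = split_node i.
Proof. by case/imfsetP => i /= i_I ->; exists i. Qed.

Lemma split_collision_free : collision_free S a d U.
Proof.
split; last split.
- move=> w1 w2 /nodeP[i le_i ->] /nodeP[j le_j ->] neq_ij t t_01.
  rewrite !traj_node // nth_uniq ?uniq_stretched ?size_walk ?size_map ?ltnS //.
  by apply: contra_neq neq_ij => ->.
- move=> u w /mem_split_nodes[i i_I ->] /nodeP[j le_j ->].
  have lt_slot_i := marked_slot_lt i_I.
  have le_slot_j : (slot j <= slot n)%N by rewrite leq_slot ?le_j /=.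
  rewrite newpos_split_node // fpos_node //; apply/eqP => /new_node_inj eq_ij.
  move: i_I; rewrite mem_marked => /andP[lt_i i_marked].
  have /eqP[] := inserted_slot_neq lt_i i_marked le_j.
  by apply: eq_ij => //; apply: ltnW.
- move=> _ _ /mem_split_nodes[i i_I ->] /mem_split_nodes[j j_I ->].
  have lt_slot_i := marked_slot_lt i_I; have lt_slot_j := marked_slot_lt j_I.
  move: (i_I) (j_I); rewrite !mem_marked => /andP[lt_i _] /andP[lt_j _].
  rewrite !newpos_split_node //; apply: contra_neq.
  move=> /(new_node_inj (ltnW lt_slot_i) (ltnW lt_slot_j))[eq_slot].
  by rewrite (slot_inj (ltnW lt_i) (ltnW lt_j) eq_slot).
Qed.

Lemma split_nodes :
  sV (step_result S a d U) =i sV (path_shape (walk a (doubled m))).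
Proof.
move=> x; rewrite in_path_shape in_fsetU.
apply/orP/(nthP pt0) => [[]/imfsetP[y y_S ->]|[k]].
- have /nodeP[j le_j ->] := y_S; exists (slot j); last by rewrite fpos_node.
  by rewrite size_walk ltnS -slot_size leq_slot ?le_j /=.
- have [i i_I ->] := mem_split_nodes y_S.
  exists (slot i).+1; last by rewrite newpos_split_node.
  by rewrite size_walk ltnS -slot_size ltnW ?marked_slot_lt.
rewrite size_walk ltnS -slot_size leq_eqVlt => /orP[/eqP->|lt_k] <-.
  left; apply/imfsetP; exists (node n); last by rewrite fpos_node.
  by apply/nodeP; exists n.
have [i lt_i] := slot_cases lt_k; case => [->|[i_marked ->]].
  left; apply/imfsetP; exists (node i); last by rewrite fpos_node ?(ltnW lt_i).
  by apply/nodeP; exists i => //; apply: ltnW.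
have i_I : i \in I by rewrite mem_marked lt_i.
right; apply/imfsetP; exists (split_node i); last by rewrite newpos_split_node.
exact: in_imfset.
Qed.

Lemma new_edgeP e :
  reflect (exists2 k, (k < slot n)%N & e = edge (new_node k) (new_node k.+1))
          (e \in sE (path_shape (walk a (doubled m)))).
Proof.
apply: (iffP (path_shape_edgeP _ _)) => -[k lt_k ->]; exists k => //;
  by rewrite size_walk slot_size in lt_k *.
Qed.

Lemma all_split : [fset u in U | splits S d u] = U.
Proof.
apply/fsetP => u; rewrite !inE /= andb_idr // => /mem_split_nodes[i i_I ->].
exact: splits_split_node.
Qed.

Lemma unsplit_edgeP e :
  reflect (exists2 i, (i < n)%N && ~~ marked i & e = edge (node i) (node i.+1))
          (e \in sE S `\` [fset edge u (padd u d) | u in U]).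
Proof.
apply: (iffP idP) => [|[i /andP[lt_i i_unmarked] ->]]; rewrite in_fsetD.
  case/andP => e_unsplit /node_edgeP[i lt_i eq_e]; exists i => //; rewrite lt_i.
  apply: contra e_unsplit => i_marked.
  have i_I : i \in I by rewrite mem_marked lt_i.
  apply/imfsetP; exists (split_node i); first exact: in_imfset.
  by rewrite paddE edge_split_node.
apply/andP; split; last by apply/node_edgeP; exists i.
apply/imfsetP => -[u /mem_split_nodes[j j_I ->]].
rewrite paddE edge_split_node //; move: j_I; rewrite mem_marked.
case/andP=> lt_j j_marked /(edge_node_inj lt_i lt_j) eq_ij.
by rewrite eq_ij j_marked in i_unmarked.
Qed.

Lemma split_edge_halves i : i \in I ->
  let u := split_node i in
  let half1 := edge (new_node (slot i)) (new_node (slot i).+1) in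
  let half2 := edge (new_node (slot i).+1) (new_node (slot i).+2) in
  let halves := (edge (fpos S a d U u) (newpos S a d U u),
                 edge (newpos S a d U u) (fpos S a d U (padd u d))) in
  halves = (half1, half2) \/ halves = (half2, half1).
Proof.
move=> i_I /=; rewrite newpos_split_node // paddE.
move: (i_I); rewrite mem_marked => /andP[lt_i i_marked].
have slot_next : slot i.+1 = (slot i).+2 by rewrite slotS // i_marked addn2.
rewrite -slot_next; case: (split_node_cases i_I) => -[-> -> _].
  by left; rewrite !fpos_node // ltnW.
by right; rewrite !fpos_node ?(ltnW lt_i) //; congr pair; exact: edgeC.
Qed.

Lemma map_node_edge i : (i < n)%N -> ~~ marked i ->
  map_edge S a d U (edge (node i) (node i.+1)) =
  edge (new_node (slot i)) (new_node (slot i).+1).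
Proof.
move=> lt_i /negPf i_unmarked; rewrite map_edge_edge !fpos_node ?(ltnW lt_i) //.
by rewrite slotS // i_unmarked addn1.
Qed.

Lemma split_edges :
  sE (step_result S a d U) =i sE (path_shape (walk a (doubled m))).
Proof.
move=> e; rewrite /step_result all_split !in_fsetU -orbA.
apply/or3P/new_edgeP => [[]/imfsetP[x x_in ->]|[k lt_k ->]].
- have /unsplit_edgeP[i /andP[lt_i i_unmarked] ->] := x_in.
  exists (slot i); last by rewrite map_node_edge.
  by have := ltn_slot (i := i) (j := n); lia.
- have [i i_I ->] := mem_split_nodes x_in; have lt_slot_i := marked_slot_lt i_I.
  by have [[-> _]|[-> _]] := split_edge_halves i_I;
     [exists (slot i); rewrite // ltnW|exists (slot i).+1].
- have [i i_I ->] := mem_split_nodes x_in; have lt_slot_i := marked_slot_lt i_I.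
  by have [[_ ->]|[_ ->]] := split_edge_halves i_I;
     [exists (slot i).+1|exists (slot i); rewrite // ltnW].
have [i lt_i slot_i] := slot_cases lt_k.
have [i_marked|i_unmarked] := boolP (marked i); last first.
  case: slot_i => [->|[i_marked]]; last by rewrite i_marked in i_unmarked.
  apply: Or31; apply/imfsetP; exists (edge (node i) (node i.+1)); last first.
    by rewrite map_node_edge.
  by apply/unsplit_edgeP; exists i; rewrite ?lt_i.
have i_I : i \in I by rewrite mem_marked lt_i.
have split_U : split_node i \in U by apply: in_imfset.
case: (split_edge_halves i_I) => -[half1E half2E]; case: slot_i => [->|[_ ->]].
- by apply: Or32; apply/imfsetP; exists (split_node i).
- by apply: Or33; apply/imfsetP; exists (split_node i).
- by apply: Or33; apply/imfsetP; exists (split_node i).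
- by apply: Or32; apply/imfsetP; exists (split_node i).
Qed.

Lemma split_growth_step : growth_step a S (path_shape (walk a (doubled m))).
Proof.
exists d, U; split=> //.
- apply/fsubsetP => u /mem_split_nodes[i i_I ->]; apply/nodeP.
  move: (i_I); rewrite mem_marked => /andP[lt_i _].
  case: (split_node_cases i_I) => -[-> _ _]; last by exists i.+1.
  by exists i; rewrite // ltnW.
- exact: split_collision_free.
by apply/esym/shape_eqP; [exact: split_nodes|exact: split_edges].
Qed.

End SplitStep.

Definition cardinal_frame (e f : pt) : bool :=
  [&& e \in cardinal_dirs, f \in cardinal_dirs & perp e f].

Lemma cardinal_frame_rot e f : cardinal_frame e f -> cardinal_frame f (- e).
Proof. by case/and3P; rewrite !inE => /or4P[]/eqP-> /or4P[]/eqP->. Qed.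

Lemma cardinal_frame_unrot e f : cardinal_frame e f -> cardinal_frame (- f) e.
Proof. by case/and3P; rewrite !inE => /or4P[]/eqP-> /or4P[]/eqP->. Qed.

Lemma orthonormal_embed e f :
  cardinal_frame e f -> orthonormal (embed e) (embed f).
Proof. by case/and3P; rewrite !inE => /or4P[]/eqP-> /or4P[]/eqP->. Qed.

Section LengthLists.
Local Open Scope nat_scope.
Implicit Types l : seq nat.

(* Segment lengths listed from the external endpoint inwards. The first length
   may be [0], and [nth] returns [0] beyond the last one. *)
Definition admissible l : Prop :=
  [/\ 1 < size l, 0 < nth 0 l 1,
      forall i, 1 < i < size l -> nth 0 l i.+2 < nth 0 l i &
      3 < size l -> nth 0 l 0 + nth 0 l 4 < nth 0 l 2].

Definition within_double l l' : Prop :=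
  size l' = size l /\ forall i, nth 0 l i <= nth 0 l' i <= (nth 0 l i).*2.

Lemma within_double_refl l : within_double l l.
Proof. by split=> // i; lia. Qed.

Lemma within_double_ind (P : seq nat -> seq nat -> Prop) :
    P [::] [::] ->
    (forall x x' l l', x <= x' <= x.*2 -> within_double l l' -> P l l' ->
       P (x :: l) (x' :: l')) ->
  forall l l', within_double l l' -> P l l'.
Proof.
move=> P_nil P_cons; elim=> [|x l IHl] [|x' l'] [] //= [size_l'] le_l'.
have l_l' : within_double l l' by split=> // i; exact: (le_l' i.+1).
by apply: P_cons => //; [exact: (le_l' 0)|exact: IHl].
Qed.

Definition alternate_axes l l' : seq nat :=
  mkseq (fun i => if odd i then nth 0 l i else nth 0 l' i) (size l).

Lemma nth0_mkseq F n i : nth 0 (mkseq F n) i = if i < n then F i else 0.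
Proof.
by case: ltnP => ?; [rewrite nth_mkseq|rewrite nth_default ?size_mkseq].
Qed.

Lemma nth_alternate_axes l l' i : size l' = size l ->
  nth 0 (alternate_axes l l') i = if odd i then nth 0 l i else nth 0 l' i.
Proof.
move=> size_l'; rewrite nth0_mkseq; case: ltnP => // le_i.
by rewrite !nth_default ?size_l' ?if_same.
Qed.

(* Each inequality relates segments of a single axis. *)
Lemma admissible_alternate_axes l l' : size l' = size l ->
  admissible l -> admissible l' -> admissible (alternate_axes l l').
Proof.
move=> size_l' [size_l pos1 dec sum] [_ _ dec' sum'].
split; rewrite ?size_mkseq //.
- by rewrite nth_alternate_axes.
- move=> i lt_i; rewrite !nth_alternate_axes //= negbK.
  by case: odd; [exact: dec|apply: dec'; rewrite size_l'].
- by move=> size4; rewrite !nth_alternate_axes //; apply: sum'; rewrite size_l'.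
Qed.

End LengthLists.

Section Weights.
Variable R : realFieldType.
Implicit Types (t : R) (l : seq nat).

Definition weights t l l' : seq (seq R) :=
  [seq nseq (p.2 - p.1)%N (1 + t) ++ nseq (p.1.*2 - p.2)%N 1 | p <- zip l l'].

Lemma nth_lengths_weights t l l' i : within_double l l' ->
  nth 0 (lengths (weights t l l')) i =
  (1 - t) * (nth 0%N l i)%:R + t * (nth 0%N l' i)%:R.
Proof.
move=> l_l'; elim/within_double_ind: l_l' i => [|x x' {}l {}l' x_x' _ IHl] [|i];
  rewrite /= ?mulr0 ?addr0 //.
have [k le_k ->] : exists2 k, (k <= x)%N & x' = (x + k)%N.
  by exists (x' - x)%N; lia.
have -> : (x.*2 - (x + k) = x - k)%N by lia.
rewrite big_cat /= !sum_nseq addKn natrD -[(1 + t) *+ k]mulr_natr natrB //.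
by ring.
Qed.

Lemma positive_weights t l l' : 0 <= t -> all positive (weights t l l').
Proof.
move=> t_ge0; rewrite /weights all_map; apply/allP => -[x x'] _ /=.
by rewrite /positive all_cat !all_nseq ltr01 (ltr_wpDr t_ge0 ltr01) !orbT.
Qed.

Lemma ltr_convex t (x y x' y' : R) : 0 <= t <= 1 -> x < y -> x' < y' ->
  (1 - t) * x + t * x' < (1 - t) * y + t * y'.
Proof.
move=> /andP[t_ge0 t_le1] lt_xy lt_xy'.
have [->|t_n0] := eqVneq t 0; first by rewrite subr0 !mul0r !addr0 !mul1r.
rewrite ler_ltD //; first by rewrite ler_wpM2l ?subr_ge0 // ltW.
by rewrite ltr_pM2l // lt_def t_n0.
Qed.

Lemma uniq_coil_weights t l l' e f : 0 <= t <= 1 -> orthonormal e f ->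
    within_double l l' -> admissible l -> admissible l' ->
  uniq (walk 0 (weighted_coil e f (weights t l l'))).
Proof.
move=> t_01 ef l_l' [size_l pos dec sum] [_ pos' dec' sum'].
have len i := nth_lengths_weights t i l_l'; have [size_l' _] := l_l'.
have size_w : size (weights t l l') = size l.
  by rewrite size_map size_zip size_l' minnn.
have w_gt0 : all positive (weights t l l').
  by apply: positive_weights; case/andP: t_01.
have ltr_mix (x y x' y' : nat) : (x < y)%N -> (x' < y')%N ->
    (1 - t) * x%:R + t * x'%:R < (1 - t) * y%:R + t * y'%:R.
  by rewrite -!(ltr_nat R); exact: ltr_convex.
case: (weights t l l') len size_w w_gt0 => [|w0 [|w1 ws]] len size_w w_gt0;
  [by rewrite -size_w in size_l | by rewrite -size_w in size_l |].
apply: uniq_weighted_coil => //.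
- have := len 1%N; rewrite /= => ->.
  by have := ltr_mix _ _ _ _ pos pos'; rewrite !mulr0 addr0.
- move=> i; rewrite size_map => lt_i.
  have := len i.+2; have := len i.+4; rewrite /= => -> ->.
  by apply: ltr_mix; [apply: dec|apply: dec']; rewrite ?size_l' -size_w.
- move=> ws_gt1; have size4 : (3 < size l)%N by rewrite -size_w.
  have := len 0%N; have := len 2%N; have := len 4%N; rewrite /= => -> -> ->.
  have := ltr_mix _ _ _ _ (sum size4) (sum' _); rewrite size_l' => /(_ size4).
  by rewrite !natrD; lra.
Qed.

End Weights.

Fixpoint marked_coil (e f : pt) (l l' : seq nat) : seq (pt * bool) :=
  if (l, l') is (x :: l1, x' :: l1') then
    nseq (x' - x)%N (e, true) ++ nseq (x.*2 - x')%N (e, false)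
      ++ marked_coil f (- e) l1 l1'
  else [::].

Lemma doubled_nseq n p : doubled (nseq n p) = nseq (n * p.2.+1)%N p.1.
Proof.
elim: n => // n IHn; rewrite -[nseq n.+1 p]/(nseq 1 p ++ nseq n p).
by rewrite doubled_cat IHn mulSn nseqD /doubled /= cats0.
Qed.

Lemma unzip1_marked_coil e f l l' : within_double l l' ->
  unzip1 (marked_coil e f l l') = coil e f l.
Proof.
move=> l_l'; elim/within_double_ind: l_l' e f => //=.
move=> x x' {}l {}l' x_x' _ IHl e f.
rewrite /unzip1 !map_cat !map_nseq -/(unzip1 _) IHl catA -nseqD.
by congr (nseq _ _ ++ _); lia.
Qed.

Lemma doubled_marked_coil e f l l' : within_double l l' ->
  doubled (marked_coil e f l l') = coil e f l'.
Proof.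
move=> l_l'; elim/within_double_ind: l_l' e f => //=.
move=> x x' {}l {}l' x_x' _ IHl e f.
rewrite !doubled_cat IHl !doubled_nseq catA -nseqD.
by congr (nseq _ _ ++ _); rewrite /=; lia.
Qed.

Lemma stretched_marked_coil t e f l l' : within_double l l' ->
  stretched t (marked_coil e f l l') =
  weighted_coil (embed e) (embed f) (weights t l l').
Proof.
move=> l_l'; elim/within_double_ind: l_l' e f => //=.
move=> x x' {}l {}l' x_x' _ IHl e f.
rewrite /stretched !map_cat !map_nseq -/(stretched _ _) IHl embedN /=.
by rewrite /segment map_cat !map_nseq mulr1 mulr0 addr0 catA.
Qed.

Lemma marked_coil_dir (odd_axis : bool) e f l l' : within_double l l' ->
    (forall i, nth 0%N l i != nth 0%N l' i -> odd i = odd_axis) ->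
  forall p, p \in marked_coil e f l l' -> p.2 ->
  let d := if odd_axis then f else e in p.1 = d \/ p.1 = - d.
Proof.
move=> l_l'; elim/within_double_ind: l_l' odd_axis e f => //=.
move=> x x' {}l {}l' x_x' _ IHl odd_axis e f axis p.
rewrite !mem_cat !mem_nseq.
case/or3P=> [/andP[x'_gt_x /eqP->] _|/andP[_ /eqP-> //]|].
  by left; have <- // : odd 0 = odd_axis; apply: axis => /=; lia.
have axis' i : nth 0%N l i != nth 0%N l' i -> odd i = ~~ odd_axis.
  by move=> /(axis i.+1) <-; rewrite negbK.
move=> p_l p2; have := IHl _ f (- e) axis' p p_l p2.
by case: (odd_axis) => /= -[->|->]; rewrite ?opprK; auto.
Qed.

Lemma uniq_admissible_coil a e f l : cardinal_frame e f -> admissible l ->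
  uniq (walk a (coil e f l)).
Proof.
move=> ef adm_l; have l_l := within_double_refl l.
rewrite uniq_walk0 -(map_inj_uniq embed_inj) map_embed_walk.
rewrite -(unzip1_marked_coil _ _ l_l) -stretched0 stretched_marked_coil //.
by apply: uniq_coil_weights => //; exact: orthonormal_embed.
Qed.

Lemma stretch_growth_step a e f odd_axis l l' : cardinal_frame e f ->
    within_double l l' -> admissible l -> admissible l' ->
    (forall i, nth 0%N l i != nth 0%N l' i -> odd i = odd_axis) ->
  growth_step a (path_shape (walk a (coil e f l)))
    (path_shape (walk a (coil e f l'))).
Proof.
move=> ef l_l' adm_l adm_l' axis; have /and3P[e_card f_card _] := ef.
rewrite -(unzip1_marked_coil e f l_l') -(doubled_marked_coil e f l_l').
apply: (split_growth_step (d := if odd_axis then f else e)).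
- by case: odd_axis {axis}.
- exact: marked_coil_dir.
- move=> t t_01; rewrite stretched_marked_coil // uniq_walk0.
  by apply: uniq_coil_weights => //; exact: orthonormal_embed.
by rewrite doubled_marked_coil // uniq_admissible_coil.
Qed.

Section Surplus.
Local Open Scope nat_scope.
Implicit Types (x : bool) (k i : nat) (s : nat -> nat) (l : seq nat).

(* The smallest admissible lengths of [k] segments whose first one is nonempty
   iff [x]. *)
Definition minimal_length x k i : nat :=
  if i is i'.+1 then
    if i' is j.+1 then uphalf (k - j.+2) + [&& x, j == 0 & 3 < k] else 1
  else x.

(* What may be added to minimal lengths; being homogeneous, these conditions
   survive halving, unlike the strict ones of [admissible]. *)
Definition nested_surplus k s : Prop :=
  (forall i, s i.+4 <= s i.+2) /\ (3 < k -> s 0 + s 4 <= s 2).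

Lemma nested_surplus_half k s :
  nested_surplus k s -> nested_surplus k (fun i => s i %/ 2).
Proof.
case=> dec sum; split=> [i|size4]; first by rewrite leq_div2r.
by apply: leq_trans (leq_div2r 2 (sum size4)); rewrite divnD // leq_addr.
Qed.

Lemma admissible_minimal_add x k k' s : 1 < k -> k <= k' <= k.+1 ->
    nested_surplus k s ->
  admissible (mkseq (fun i => minimal_length x k' i + s i) k).
Proof.
move=> k_gt1 k_k' [dec sum]; split; rewrite ?size_mkseq ?nth0_mkseq ?k_gt1 //.
  move=> [|[|i]] // /andP[_ lt_i]; rewrite !nth0_mkseq lt_i.
  by have := dec i; case: ifP => _ /=; lia.
move=> size4; have := sum size4; rewrite /=.
have -> : 0 < k by lia.
have -> : 2 < k by lia.
have -> : 3 < k' by lia.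
by case: ifP => _; case: x => /=; lia.
Qed.

Lemma admissible_minimal x k k' : 1 < k -> k <= k' <= k.+1 ->
  admissible (mkseq (minimal_length x k') k).
Proof.
move=> k_gt1 k_k'; have := @admissible_minimal_add x k k' (fun=> 0) k_gt1 k_k'.
by under eq_mkseq do rewrite addn0; apply.
Qed.

Lemma uphalf_leq_nth l i : admissible l ->
  uphalf (size l - i.+2) <= nth 0 l i.+2.
Proof.
case=> _ _ dec _; have [k] := ubnP (size l - i.+2).
elim: k i => // k IHk i lt_k.
have [lt_i|le_i] := ltnP i.+2 (size l); last by rewrite (eqP le_i).
have lt_nth : nth 0 l i.+4 < nth 0 l i.+2 by apply: dec.
by have := IHk i.+2; lia.
Qed.

Lemma minimal_length_leq l i : admissible l ->
  minimal_length (0 < nth 0 l 0) (size l) i <= nth 0 l i.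
Proof.
move=> adm_l; have [_ pos _ sum] := adm_l; case: i => [|[|[|i]]] //=.
- by case: (nth 0 l 0).
- have := uphalf_leq_nth 0 adm_l; have := uphalf_leq_nth 2 adm_l.
  by case: (ltnP 3 (size l)) => [/[dup] size4 /sum|]; case: posnP; lia.
- by rewrite andbF addn0 uphalf_leq_nth.
Qed.

Lemma nested_surplus_minimal l : admissible l ->
  nested_surplus (size l)
    (fun i => nth 0 l i - minimal_length (0 < nth 0 l 0) (size l) i).
Proof.
move=> adm_l; have min_leq i := minimal_length_leq i adm_l.
have [_ _ dec sum] := adm_l.
split=> [i|size4].
  have [lt_i|le_i] := ltnP i.+4 (size l); last first.
    by rewrite [nth 0 l i.+4]nth_default.
  have lt_nth : nth 0 l i.+4 < nth 0 l i.+2 by apply: dec; lia.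
  have := min_leq i.+4; have size4 : 3 < size l by lia.
  case: i lt_i lt_nth => [|i] lt_i lt_nth /=; rewrite ?andbF; last by lia.
  by have := sum size4; case: posnP => /=; lia.
have := sum size4; have := min_leq 0; have := min_leq 4; have := min_leq 2.
by rewrite /= size4; case: posnP => /=; lia.
Qed.

Lemma within_double_minimal x k :
  within_double (mkseq (minimal_length x k) k)
    (mkseq (minimal_length x k.+1) k).
Proof.
split; rewrite ?size_mkseq // => i; rewrite !nth0_mkseq; case: ifP => // lt_i.
by case: i lt_i => [|[|[|i]]] lt_i /=; rewrite ?andbF; case: x => /=; lia.
Qed.

Lemma mkseq_minimal_length_rcons x k : 1 < k ->
  mkseq (minimal_length x k.+1) k.+1 =
  rcons (mkseq (minimal_length x k.+1) k) 1.
Proof.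
by rewrite mkseqS; case: k => [|[|[|k]]] // _; rewrite /= ?subSnn ?andbF.
Qed.

Lemma within_double_half k c s : (forall i, i < k -> 0 < c i \/ s i = 0) ->
  within_double (mkseq (fun i => c i + s i %/ 2) k)
    (mkseq (fun i => c i + s i) k).
Proof.
move=> pos; split; rewrite ?size_mkseq // => i; rewrite !nth0_mkseq.
by case: ifP => // /pos; lia.
Qed.

End Surplus.

Section GrownWithin.
Local Open Scope nat_scope.
Implicit Types (a d e f : pt) (v : seq pt) (l : seq nat).

Definition grown_within a t v : Prop :=
  exists2 t', t' <= t &
    grows a t' (Shape [fset a]%fset fset0) (path_shape (walk a v)).

Lemma grown_nil a t : grown_within a t [::].
Proof. by exists 0; rewrite ?path_shape1 //; exact: grows0. Qed.

Lemma grown_within_leq a t t' v :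
  t <= t' -> grown_within a t v -> grown_within a t' v.
Proof.
by move=> le_t [t0 le_t0 grow]; exists t0; rewrite // (leq_trans le_t0).
Qed.

Lemma grown_step a t v v' :
    growth_step a (path_shape (walk a v)) (path_shape (walk a v')) ->
  grown_within a t v -> grown_within a t.+1 v'.
Proof.
by move=> step [t' le_t' grow]; exists t'.+1 => //; apply: growsS step.
Qed.

Lemma grown_rcons a t v d : d \in cardinal_dirs -> uniq (walk a (rcons v d)) ->
  grown_within a t v -> grown_within a t.+1 (rcons v d).
Proof.
move=> d_card; rewrite (walk_rcons pt0) rcons_uniq => /andP[new _].
apply: grown_step; rewrite (walk_rcons pt0) path_shape_rcons //.
have last_in : last pt0 (walk a v) \in walk a v by exact: (mem_last a).
apply: leaf_growth_step; rewrite ?in_path_shape //.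
apply: contra new => /path_shape_edgeP[i lt_i /edge_inj].
by case=> -[_ ->]; apply: mem_nth; rewrite // ltnW.
Qed.

Lemma coil_rcons1 e f l : cardinal_frame e f ->
  exists2 d, d \in cardinal_dirs & coil e f (rcons l 1) = rcons (coil e f l) d.
Proof.
elim: l e f => [|n l IHl] e f ef /=; first by exists e; case/and3P: ef.
have [d d_card ->] := IHl _ _ (cardinal_frame_rot ef).
by exists d; rewrite // rcons_cat.
Qed.

Variables (a e f : pt).
Hypothesis ef : cardinal_frame e f.

Lemma grown_stretch l l' t :
    within_double l l' -> admissible l -> admissible l' ->
  grown_within a t (coil e f l) -> grown_within a t.+2 (coil e f l').
Proof.
move=> [size_l' l_l'] adm_l adm_l' grow.
have nthE i := nth_alternate_axes i size_l'.
have adm_m := admissible_alternate_axes size_l' adm_l adm_l'.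
apply: (grown_step (v := coil e f (alternate_axes l l'))).
  apply: (@stretch_growth_step _ _ _ true) => // [|i].
    split; rewrite ?size_mkseq // => i; rewrite nthE.
    by case: odd => //; have := l_l' i; lia.
  by rewrite nthE; case: odd; rewrite ?eqxx.
apply: grown_step grow; apply: (@stretch_growth_step _ _ _ false) => // [|i].
  by split; rewrite ?size_mkseq // => i; rewrite nthE; case: odd => //; lia.
by rewrite nthE; case: odd; rewrite ?eqxx.
Qed.

Lemma grown_minimal x k :
  grown_within a (3 * k.+2) (coil e f (mkseq (minimal_length x k.+2) k.+2)).
Proof.
have adm_min j j' : j <= j' <= j.+1 ->
    admissible (mkseq (minimal_length x j'.+2) j.+2).
  by move=> j_j'; apply: admissible_minimal.
have uniq_min j : uniq (walk a (coil e f (mkseq (minimal_length x j.+2) j.+2))).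
  by apply: uniq_admissible_coil => //; apply: adm_min; rewrite leqnn leqnSn.
elim: k => [|k IHk].
  have [e_card f_card _] := and3P ef; have := uniq_min 0.
  have -> : coil e f (mkseq (minimal_length x 2) 2) = rcons (nseq x e) f.
    by case: (x).
  move=> uniq_min2; apply: (@grown_within_leq a 2) => //.
  apply: grown_rcons => //.
  case: (x) uniq_min2 => uniq_min2; last exact: grown_nil.
  apply: (grown_rcons (v := [::])) => //; last exact: grown_nil.
  by move: uniq_min2; rewrite /= !inE negb_or -andbA => /andP[->].
have := uniq_min k.+1.
rewrite mkseq_minimal_length_rcons //; set l := mkseq _ _.
have [d d_card ->] := coil_rcons1 l ef.
move=> uniq_min_rcons; rewrite mulnS !addSn add0n; apply: grown_rcons => //.
apply: grown_stretch IHk; first exact: within_double_minimal.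
  by apply: adm_min; rewrite leqnn leqnSn.
by apply: (adm_min k k.+1); rewrite leqnSn leqnn.
Qed.

(* Halving the surplus at most halves every length, so [R] stretchings
   suffice. *)
Lemma grown_surplus x k s R :
    nested_surplus k.+2 s -> (forall i, s i < 2 ^ R) ->
    (forall i, i < k.+2 -> 0 < minimal_length x k.+2 i \/ s i = 0) ->
  grown_within a (3 * k.+2 + 2 * R)
    (coil e f (mkseq (fun i => minimal_length x k.+2 i + s i) k.+2)).
Proof.
elim: R s => [|R IHR] s nested lt_s pos.
  have s0 i : minimal_length x k.+2 i + s i = minimal_length x k.+2 i.
    by have := lt_s i; lia.
  by rewrite muln0 addn0 (eq_mkseq s0); exact: grown_minimal.
have half := nested_surplus_half nested.
have adm s' : nested_surplus k.+2 s' ->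
    admissible (mkseq (fun i => minimal_length x k.+2 i + s' i) k.+2).
  by apply: admissible_minimal_add; rewrite ?leqnn ?leqnSn.
rewrite [2 * _]mulnS addnCA !addSn add0n.
apply: grown_stretch (IHR _ half _ _); try exact: adm.
- exact: within_double_half.
- by move=> i; rewrite ltn_divLR // -expnSr.
by move=> i /pos[]; [left|right; lia].
Qed.

Lemma grown_admissible l R : admissible l -> (forall i, nth 0 l i < 2 ^ R) ->
  grown_within a (3 * size l + 2 * R) (coil e f l).
Proof.
move=> adm_l lt_l; have [size_l _ _ _] := adm_l.
have min_leq i := minimal_length_leq i adm_l.
set x := 0 < nth 0 l 0 in min_leq; set c := minimal_length x _ in min_leq.
have [k size_k] : exists k, size l = k.+2 by exists (size l).-2; lia.
have -> : l = mkseq (fun i => c i + (nth 0 l i - c i)) (size l).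
  apply: (@eq_from_nth _ 0); rewrite ?size_mkseq // => i lt_i.
  by rewrite nth_mkseq // subnKC.
rewrite size_mkseq /c size_k; apply: grown_surplus.
- by rewrite -size_k; exact: nested_surplus_minimal.
- by move=> i; apply: leq_ltn_trans (lt_l i); rewrite leq_subr.
case=> [|[|i]] lt_i; [rewrite /x /= |by left|left => /=; lia].
by case: (posnP (nth 0 l 0)) => [->|_]; [right|left].
Qed.

End GrownWithin.

Section UniqueCoils.
Variable V : zmodType.
Implicit Types (a e f : V) (l : seq nat).

Lemma uniq_coil_open a e f l i : all (leq 1) l -> uniq (walk a (coil e f l)) ->
    (i.+3 < size l)%N ->
  (nth 0 l i < nth 0 l i.+2)%N \/ (nth 0 l i.+3 < nth 0 l i.+1)%N.
Proof.
move=> l_gt0 uniq_l lt_i.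
have [|le02] := ltnP (nth 0%N l i) (nth 0%N l i.+2); first by left.
have [|le13] := ltnP (nth 0%N l i.+3) (nth 0%N l i.+1); first by right.
have l1_gt0 : (0 < nth 0%N l i.+1)%N by apply: (all_nthP 0%N l_gt0); lia.
exfalso; move: uniq_l le02 le13 l1_gt0; rewrite -{1}(cat_take_drop i l).
have [e' [f' ->]] := coil_cat e f (take i l) (drop i l).
do 4!(rewrite (drop_nth 0%N); last by lia).
move: (nth _ l i) (nth _ l i.+1) (nth _ l i.+2) (nth _ l i.+3) => l0 l1 l2 l3.
move=> /uniq_walk_catr uniq_l le02 le13 l1_gt0.
have coilE : coil e' f' [:: l0, l1, l2, l3 & drop i.+4 l] =
    nseq (l0 - l2)%N e' ++
    (nseq l2 e' ++ nseq l1 f' ++ nseq l2 (- e') ++ nseq l1 (- f')) ++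
    (nseq (l3 - l1)%N (- f') ++ coil (- - e') (- - f') (drop i.+4 l)).
  by rewrite /= -{1}(subnK le02) -{1}(subnKC le13) !nseqD -!catA.
move: uniq_l; rewrite coilE => /uniq_walk_catr/uniq_walk_no_cycle.
rewrite !big_cat /= !sum_nseq !mulNrn -opprD addrA subrr => /(_ erefl).
by case: (l2) => //; case: (l1) l1_gt0.
Qed.

(* The second and fourth segments have the same length, so the fifth one runs
   along the line of the first one, towards [a]. *)
Lemma uniq_coil_fifth_short a e f (l0 l1 l2 l4 : nat) l :
    uniq (walk a (coil e f [:: l0, l1, l2, l1, l4 & l])) ->
  (0 < l0)%N -> (l0 < l2)%N -> (l0 + l4 < l2)%N.
Proof.
move=> uniq_l l0_gt0 lt02; rewrite ltnNge; apply/negP => le2.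
have le24 : (l2 - l0 <= l4)%N by lia.
have coilE : coil e f [:: l0, l1, l2, l1, l4 & l] =
    (nseq l0 e ++ nseq l1 f ++ nseq l2 (- e) ++ nseq l1 (- f)
      ++ nseq (l2 - l0)%N e) ++
    (nseq (l4 - (l2 - l0))%N e ++ coil (- - f) (- e) l).
  by rewrite /= -{1}(subnKC le24) !nseqD !opprK -!catA.
move: uniq_l; rewrite coilE => /uniq_walk_no_cycle.
rewrite !big_cat /= !sum_nseq mulrnBr ?(ltnW lt02) // !mulNrn => closed.
have cancel x y z : x + (y + (- z + (- y + (z - x)))) = 0 :> V.
  by rewrite [- z + _]addrCA addKr [- y - x]addrC -opprD addrA subrr.
by case: (l0) l0_gt0 (closed (cancel _ _ _)).
Qed.

Lemma uniq_coil_growing_before a e f l j : all (leq 1) l ->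
    uniq (walk a (coil e f l)) -> (j.+2 < size l)%N ->
    (nth 0 l j <= nth 0 l j.+2)%N ->
  forall i, (i < j)%N -> (nth 0 l i < nth 0 l i.+2)%N.
Proof.
move=> l_gt0 uniq_l; elim: j => // j IHj lt_j le_j i.
have lt_nth : (nth 0%N l j < nth 0%N l j.+2)%N.
  by have [//|] := uniq_coil_open l_gt0 uniq_l lt_j; rewrite ltnNge le_j.
by rewrite ltnS leq_eqVlt => /orP[/eqP->//|]; apply: IHj; apply: ltnW.
Qed.

End UniqueCoils.

Lemma pt_mulrn (p : pt) n : p *+ n = (n%:Z * p.1, n%:Z * p.2).
Proof.
elim: n => [|n IHn]; first by rewrite !mul0r.
by rewrite mulrS IHn intS !mulrDl !mul1r.
Qed.

Section OuterCoils.
Variables (a e f : pt) (l : seq nat).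
Hypothesis ef : cardinal_frame e f.
Hypothesis l_gt0 : all (leq 1) l.
Hypothesis uniq_l : uniq (walk a (coil e f l)).
Hypothesis outer_a : on_outer_boundary (walk a (coil e f l)) a.

(* Otherwise the first four corners would surround [a]. *)
Lemma outer_coil_not_growing : (3 < size l)%N ->
  ~ ((nth 0 l 0 < nth 0 l 2)%N /\ (nth 0 l 1 < nth 0 l 3)%N).
Proof.
have corner u w : coil e f l = u ++ w ->
    a + \sum_(x <- u) x \in walk a (coil e f l).
  by move->; exact: mem_walk_prefix.
case: l l_gt0 corner outer_a => [|l0 [|l1 [|l2 [|l3 r]]]] //.
move=> /and5P[l0_gt0 l1_gt0 _ _ _] corner outer _ /= [lt02 lt13].
have c1 := corner (nseq l0 e) _ erefl.
have c2 := corner (nseq l0 e ++ nseq l1 f) _ (catA _ _ _).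
have := corner (nseq l0 e ++ nseq l1 f ++ nseq l2 (- e))
  (nseq l3 (- f) ++ coil (- - e) (- - f) r).
have := corner (nseq l0 e ++ nseq l1 f ++ nseq l2 (- e) ++ nseq l3 (- f))
  (coil (- - e) (- - f) r).
rewrite /= -!catA => /(_ erefl) c4 /(_ erefl) c3.
move: c1 c2 c3 c4; rewrite !big_cat /= !sum_nseq !pt_mulrn.
case: (a) outer => a1 a2 outer c1 c2 c3 c4.
case/or4P: outer => /allP outer;
  move: (outer _ c1) (outer _ c2) (outer _ c3) (outer _ c4);
  case/and3P: ef => {outer c1 c2 c3 c4};
  by rewrite !inE => /or4P[]/eqP-> /or4P[]/eqP-> //= _; lia.
Qed.

Lemma outer_coil_shrinks i : (1 < i < size l)%N -> (nth 0 l i.+2 < nth 0 l i)%N.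
Proof.
move=> /andP[i_gt1 lt_i]; have [lt_i2|le_i2] := ltnP i.+2 (size l); last first.
  by rewrite nth_default //; apply: (all_nthP 0%N l_gt0).
rewrite ltnNge; apply/negP => le_nth.
apply: outer_coil_not_growing; first by lia.
have growing := uniq_coil_growing_before l_gt0 uniq_l lt_i2 le_nth.
by split; apply: growing; lia.
Qed.

Lemma admissible_cons0 : l != [::] ->
    (forall i, (0 < i < size l)%N -> (nth 0 l i.+2 < nth 0 l i)%N) ->
  admissible (0%N :: l).
Proof.
move=> l_n0 shrinks; have l_size : (0 < size l)%N by case: (l) l_n0.
split=> //=; first exact: (all_nthP 0%N l_gt0).
  by case=> [|i] // lt_i; apply: shrinks.
by move=> size_l; apply: shrinks; apply: ltnW.
Qed.

Lemma admissible_second_leq_fourth :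
  (1 < size l)%N -> (nth 0 l 1 <= nth 0 l 3)%N -> admissible l.
Proof.
move=> size_l le13; have pos k : (k < size l)%N -> (0 < nth 0%N l k)%N.
  by move=> lt_k; apply: (all_nthP 0%N l_gt0).
have size4 : (3 < size l)%N.
  rewrite ltnNge; apply/negP => /(nth_default 0%N) l3_eq0.
  by have := pos _ size_l; lia.
have [lt02|] := uniq_coil_open l_gt0 uniq_l size4; last by rewrite ltnNge le13.
have eq13 : nth 0%N l 3 = nth 0%N l 1.
  apply/eqP; rewrite eqn_leq le13 andbT leqNgt; apply/negP => lt13.
  exact: outer_coil_not_growing.
split=> // [|i|_]; [exact: pos|exact: outer_coil_shrinks|].
have := pos 0%N (ltnW size_l).
case: l size4 uniq_l lt02 eq13 => [|l0 [|l1 [|l2 [|l3 [|l4 r]]]]] //= _.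
  by rewrite addn0.
move=> + lt02 eq13 l0_gt0; rewrite eq13 => uniq_r.
exact: uniq_coil_fifth_short uniq_r l0_gt0 lt02.
Qed.

Lemma admissible_outer_coil : l != [::] -> exists e' f' l',
  [/\ cardinal_frame e' f', admissible l', coil e' f' l' = coil e f l
    & (size l' <= (size l).+1)%N].
Proof.
move=> l_n0; have [|] := boolP ((1 < size l)%N && (nth 0 l 1 <= nth 0 l 3)%N).
  case/andP => size_l le13; exists e, f, l.
  by split=> //; exact: admissible_second_leq_fourth.
rewrite negb_and -leqNgt -ltnNge => first_shrinks; exists (- f), e, (0%N :: l).
rewrite cardinal_frame_unrot //= opprK; split=> //.
apply: admissible_cons0 => // -[|[|i]] // lt_i.
  by case/orP: first_shrinks => //; lia.
exact: outer_coil_shrinks.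
Qed.

End OuterCoils.

Lemma psubE (p q : pt) : psub p q = p - q.
Proof. by []. Qed.

Definition quarter_turn (rot : pt -> pt) : Prop :=
  rot = rot_ccw \/ rot = rot_cw.

Section ReversedPaths.
Implicit Types (p q : pt) (s : seq pt).

Lemma adjacentC p q : adjacent p q = adjacent q p.
Proof. by rewrite /adjacent; lia. Qed.

Lemma perpC p q : perp p q = perp q p.
Proof. by rewrite /perp ![p.1 * _]mulrC ![p.2 * _]mulrC. Qed.

Lemma perpNN p q : perp (- p) (- q) = perp p q.
Proof. by rewrite /perp /= !mulrNN. Qed.

Lemma pdir_rev s i : (i.+1 < size s)%N ->
  pdir (rev s) i = - pdir s (size s - i.+2).
Proof.
move=> lt_i; rewrite /pdir !nth_rev ?(ltnW lt_i) // (subnSK lt_i).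
exact/esym/opprB.
Qed.

Lemma perp_pdir_rev s i : (0 < i)%N -> (i.+1 < size s)%N ->
  perp (pdir (rev s) i.-1) (pdir (rev s) i) =
  perp (pdir s (size s - i.+1).-1) (pdir s (size s - i.+1)).
Proof.
case: i => // i _ lt_i; rewrite !pdir_rev //= ?(ltnW lt_i) // perpNN perpC.
by rewrite subnS.
Qed.

Lemma grid_path_rev s : grid_path s -> grid_path (rev s).
Proof.
case: s => // x s /andP[uniq_s path_s].
have rev_xs : rev (x :: s) = last x s :: rev (belast x s).
  by rewrite lastI rev_rcons.
rewrite rev_xs /grid_path -rev_xs rev_uniq uniq_s rev_path.
by under eq_path do rewrite adjacentC.
Qed.

Lemma turning_rev s i : (i < size s)%N ->
  turning (rev s) i = turning s (size s - i.+1).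
Proof.
move=> lt_i; rewrite /turning size_rev.
case: (posnP i) => [->|i_gt0]; first by rewrite subn1 eqxx orbT.
have [lt_iS|le_iS] := ltnP i.+1 (size s); last first.
  by have -> : i = (size s).-1 by [lia]; rewrite eqxx /= prednK ?subnn //; lia.
rewrite perp_pdir_rev //; have -> : (size s - i.+1 == 0)%N = false by lia.
have -> : (size s - i.+1 == (size s).-1)%N = false by lia.
by have -> : (i == (size s).-1)%N = false by lia.
Qed.

Lemma num_turning_rev s : num_turning (rev s) = num_turning s.
Proof.
rewrite /num_turning size_rev; set n := size s.
rewrite (@eq_in_count _ _ (turning s \o (fun i => n - i.+1)%N)); last first.
  by move=> i; rewrite mem_iota => lt_i; rewrite turning_rev.
rewrite -count_map -[RHS]count_rev; congr count.
apply: (@eq_from_nth _ 0%N); rewrite size_map ?size_rev // size_iota => i lt_i.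
by rewrite nth_rev size_iota // (nth_map 0%N) ?size_iota // !nth_iota //; lia.
Qed.

Lemma spiral_rev s : spiral s -> spiral (rev s).
Proof.
case=> path_s [rot [rot_def turns]]; split; first exact: grid_path_rev.
have [rot' rot'_def rotK] :
    exists2 rot', quarter_turn rot' & forall p, rot' (- rot p) = - p.
  case: rot_def => ->; [exists rot_cw|exists rot_ccw]; rewrite /quarter_turn;
    by [auto|case=> x y; rewrite /rot_cw /rot_ccw /= opprK].
exists rot'; split=> // -[|i] // _; rewrite size_rev => lt_i.
rewrite perp_pdir_rev //= => /turns turn_i; rewrite !pdir_rev ?(ltnW lt_i) //.
rewrite turn_i ?rotK //; last by lia.
  by rewrite -subnS.
by lia.
Qed.

End ReversedPaths.

Section Changes.
Variable T : eqType.

Definition changes (u : T) (v : seq T) : nat :=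
  count id (pairmap (fun x y => y != x) u v).

Lemma changes_cons u x v : changes u (x :: v) = ((x != u) + changes x v)%N.
Proof. by []. Qed.

Lemma changes_leq_count (P : pred nat) u v :
    (forall i, (i < size v)%N -> nth u v i != nth u (u :: v) i -> P i.+1) ->
  (changes u v <= count P (iota 1 (size v)))%N.
Proof.
elim: v u P => //= x v IHv u P changed; rewrite changes_cons leq_add //.
  by have := changed 0%N isT; case: (x != u) => //= ->.
rewrite -[2%N]/(1 + 1)%N iotaDl count_map; apply: IHv => i lt_i.
rewrite !(set_nth_default u x) //; last by rewrite ltnW.
exact: (changed i.+1).
Qed.

End Changes.

Section CoilOfTurns.
Variables (V : zmodType) (rot : V -> V).
Hypothesis rotK : forall x, rot (rot x) = - x.

Lemma coil_of_turns u v :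
    path (fun x y => (y == x) || (y == rot x)) u v ->
  exists l, [/\ all (leq 1) l, l != [::], u :: v = coil u (rot u) l
    & size l = (changes u v).+1].
Proof.
elim: v u => [|x v IHv] u /=; first by exists [:: 1%N].
case/andP => turn /IHv[l [l_gt0 l_n0 coil_l size_l]].
have [eq_xu|neq_xu] := eqVneq x u.
  case: l l_gt0 l_n0 coil_l size_l => // n l /andP[_ l_gt0] _ coil_l size_l.
  exists (n.+1 :: l); subst x; split=> //; first by rewrite coil_l.
  by rewrite changes_cons eqxx.
exists (1%N :: l); rewrite changes_cons neq_xu /= l_gt0 size_l; split=> //.
case/orP: turn neq_xu => /eqP eq_x; first by rewrite eq_x eqxx.
by rewrite coil_l eq_x rotK.
Qed.

End CoilOfTurns.

Section Spirals.
Implicit Types (a p q : pt) (s : seq pt).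

Lemma adjacent_cardinal p q : adjacent p q -> q - p \in cardinal_dirs.
Proof.
case: p q => [p1 p2] [q1 q2]; rewrite /adjacent !inE !xpair_eqE /=; lia.
Qed.

Lemma cardinal_not_perp p q : p \in cardinal_dirs -> q \in cardinal_dirs ->
  ~~ perp p q -> q = p \/ q = - p.
Proof. by rewrite !inE => /or4P[]/eqP-> /or4P[]/eqP-> //=; auto. Qed.

Lemma pdir_cardinal s i : grid_path s -> (i.+1 < size s)%N ->
  pdir s i \in cardinal_dirs.
Proof.
case: s => // x s /andP[_ /(pathP pt0) adj] lt_i.
by apply: adjacent_cardinal; apply: adj.
Qed.

Lemma pdir_no_reversal s i : grid_path s -> (i.+2 < size s)%N ->
  pdir s i.+1 != - pdir s i.
Proof.
case: s => // x s /andP[uniq_s _] lt_i; apply/eqP => rev_dir.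
have : nth pt0 (x :: s) i.+2 == nth pt0 (x :: s) i.
  rewrite -subr_eq0 -(subrK (nth pt0 (x :: s) i.+1) (nth _ _ i.+2)).
  by rewrite -addrA [X in X + _]rev_dir addrC subrr.
by rewrite nth_uniq // ?(ltnW (ltnW lt_i)) //; lia.
Qed.

Lemma quarter_turnK rot p : quarter_turn rot -> rot (rot p) = - p.
Proof. by case=> ->; case: p => x y; rewrite /rot_ccw /rot_cw. Qed.

Lemma cardinal_frame_turn rot e :
  quarter_turn rot -> e \in cardinal_dirs -> cardinal_frame e (rot e).
Proof. by move=> [] ->; rewrite !inE => /or4P[]/eqP->. Qed.

Lemma pdir_walk a v i : (i < size v)%N -> pdir (walk a v) i = nth pt0 v i.
Proof. by move=> lt_i; rewrite /pdir nth_walkS // psubE addrAC subrr add0r. Qed.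

Lemma spiral_walk_turn a u v : spiral (walk a (u :: v)) ->
  exists2 rot, quarter_turn rot & forall i, (i < size v)%N ->
    nth pt0 v i = nth pt0 (u :: v) i \/
    turning (walk a (u :: v)) i.+1 /\ nth pt0 v i = rot (nth pt0 (u :: v) i).
Proof.
set s := walk a (u :: v); case=> path_s [rot [rot_def turns]].
exists rot => // i lt_i; have lt_iSS : (i.+2 < size s)%N by rewrite size_walk.
have -> : nth pt0 v i = pdir s i.+1 by rewrite pdir_walk.
have -> : nth pt0 (u :: v) i = pdir s i by rewrite pdir_walk // ltnW.
have [turn|straight] := boolP (perp (pdir s i) (pdir s i.+1)).
  by right; split; [rewrite /turning turn !orbT|apply: turns].
have card_i := pdir_cardinal path_s (ltnW lt_iSS).
have [|/eqP reversed] :=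
    cardinal_not_perp card_i (pdir_cardinal path_s lt_iSS) straight.
  by left.
by rewrite (negPf (pdir_no_reversal path_s lt_iSS)) in reversed.
Qed.

Lemma changes_lt_num_turning a u v : spiral (walk a (u :: v)) ->
  (changes u v < num_turning (walk a (u :: v)))%N.
Proof.
move=> /spiral_walk_turn[rot _ turn]; set s := walk a (u :: v) in turn *.
have -> : num_turning s = (count (turning s) (iota 1 (size v).+1)).+1.
  by rewrite /num_turning size_walk.
rewrite ltnS -[X in iota 1 X]addn1 iotaD count_cat.
apply: leq_trans (leq_addr _ _); apply: changes_leq_count => i lt_i neq_i.
have [eq_i|[]//] := turn i lt_i.
rewrite (set_nth_default pt0) // (set_nth_default pt0 u) in neq_i.
  by rewrite eq_i eqxx in neq_i.
exact: ltnW.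
Qed.

Lemma spiral_coil s : spiral s -> (1 < size s)%N -> exists e f l,
  [/\ cardinal_frame e f, all (leq 1) l, l != [::],
      s = walk (head pt0 s) (coil e f l) & (size l <= num_turning s)%N].
Proof.
case: s => [|a [|b s]] // + _; rewrite -[_ :: _]walk_differences /=.
set u := b - a; set v := pairmap _ _ _ => spiral_v; have [path_v _] := spiral_v.
have [rot rot_def turn] := spiral_walk_turn spiral_v.
have [|l [l_gt0 l_n0 coil_l size_l]] :=
    coil_of_turns (fun p => quarter_turnK p rot_def) (u := u) (v := v).
  by apply/(pathP pt0) => i /turn[->|[_ ->]]; rewrite eqxx ?orbT.
exists u, (rot u), l; split=> //.
- apply: cardinal_frame_turn => //; rewrite -[u]/(nth pt0 (u :: v) 0).
  by rewrite -(pdir_walk a) // pdir_cardinal // size_walk.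
- by rewrite coil_l.
by rewrite size_l changes_lt_num_turning.
Qed.

End Spirals.

Lemma nth_leq_sumn l i : (nth 0 l i <= sumn l)%N.
Proof.
elim: l i => [|n l IHl] [|i] //=; first exact: leq_addr.
by rewrite (leq_trans (IHl i)) // leq_addl.
Qed.

Lemma on_outer_boundary_rev s p :
  on_outer_boundary (rev s) p = on_outer_boundary s p.
Proof. by rewrite /on_outer_boundary !all_rev. Qed.

Lemma grown_inward_spiral s : spiral s -> on_outer_boundary s (head pt0 s) ->
  exists2 t, (t <= 3 * (num_turning s).+1 + 2 * (trunc_log 2 (size s)).+1)%N
    & grows (head pt0 s) t (Shape [fset head pt0 s] fset0) (path_shape s).
Proof.
move=> spiral_s outer_a; have [size_s|] := ltnP 1 (size s); last first.
  case: s spiral_s {outer_a} => [|x [|y s]] [] // _ _ _; exists 0%N => //.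
  by rewrite path_shape1; exact: grows0.
have [e [f [l [ef l_gt0 l_n0 s_walk size_l]]]] := spiral_coil spiral_s size_s.
set a := head pt0 s in outer_a s_walk *.
have uniq_l : uniq (walk a (coil e f l)).
  by rewrite -s_walk; case: spiral_s => + _; case: (s) => // x s' /andP[].
have [|e' [f' [l' [ef' adm_l' coil_l' size_l']]]] :=
    admissible_outer_coil ef l_gt0 uniq_l _ l_n0; first by rewrite -s_walk.
have lt_l' i : (nth 0 l' i < 2 ^ (trunc_log 2 (size s)).+1)%N.
  apply: leq_ltn_trans (trunc_log_ltn (size s) (isT : (1 < 2)%N)).
  rewrite s_walk size_walk -coil_l' size_coil.
  exact: leqW (nth_leq_sumn _ _).
have [t le_t] := grown_admissible a ef' adm_l' lt_l'.
rewrite coil_l' -s_walk => grow; exists t => //; apply: leq_trans le_t _.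
by rewrite leq_add2r leq_mul2l (leq_trans size_l').
Qed.

(* [s] lists the spiral from its internal endpoint tp_1 to its external endpoint
   tp_k. *)
Theorem theorem3p3 :
  forall c : nat, exists C : nat,
  forall s : seq pt,
    spiral s ->
    on_outer_boundary s (last pt0 s) ->
    (num_turning s <= c * (trunc_log 2 (size s)).+1)%N ->
    exists t : nat, (t <= C * (trunc_log 2 (size s)).+1)%N /\
      grows (last pt0 s) t (Shape [fset last pt0 s] fset0) (path_shape s).
Proof.
move=> c; exists (3 * c + 5)%N => s spiral_s outer few_turns.
have head_rev : head pt0 (rev s) = last pt0 s.
  case/lastP: s {spiral_s outer few_turns} => // s x.
  by rewrite rev_rcons last_rcons.
have [|t le_t] := grown_inward_spiral (spiral_rev spiral_s).
  by rewrite head_rev on_outer_boundary_rev.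
rewrite head_rev path_shape_rev => grow; exists t; split=> //.
apply: leq_trans le_t _; rewrite num_turning_rev size_rev.
by move: few_turns; set R := (trunc_log 2 (size s)).+1; nia.
Qed.
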